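(* There exist absolute constants $C_1,C_2>0$ such that the following holds. For every $0<\beta<\frac15$ there exists $C>0$ such that if $G=G(n,p)$ where $p\ge\frac Cn$, then for any integer $t$ with $\frac{C_1}{\log(1/\beta)}\cdot\log n\le t\le(1-C_2\beta)n$, with probability $1-e^{-\Omega(n)}$, $$ex(G(n,p),C_t)\le\left(\frac{ex(n,C_t)}{\binom n2}+\beta\right)e(G(n,p)).$$
   Context: Graphs are finite and simple; $e(G)$ is the number of edges of $G$; $\log$ is the natural logarithm; $C_t$ is the cycle of length $t$ (with $t$ edges). For graphs $G,H$, $ex(G,H)$ is the maximum number of edges in a subgraph of $G$ containing no copy of $H$, and $ex(n,H)=ex(K_n,H)$. $G(n,p)$ is the binomial random graph on vertex set $\{1,\dots,n\}$, in which each pair of vertices is an edge independently with probability $p=p(n)\in[0,1]$. Asymptotic notation is as $n\to\infty$: ''with probability $1-e^{-\Omega(n)}$'' means with probability at least $1-e^{-cn}$ for all sufficiently large $n$, for some constant $c>0$ (which may depend on $\beta$). *)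

(* Defs.v *)
From HB Require Import structures.
From mathcomp Require Import all_boot all_order all_algebra.
From mathcomp Require Import reals.

Set Implicit Arguments.
Unset Strict Implicit.
Unset Printing Implicit Defensive.

Import Order.TTheory GRing.Theory Num.Theory.

Definition pairs (T : finType) : {set {set T}} := [set e : {set T} | #|e| == 2].

(* Finite simple graphs on the vertex set T. *)
Record sgraph (T : finType) := SGraph {
  edges : {set {set T}};
  edges_pairs : edges \subset pairs T
}.

HB.instance Definition _ (T : finType) := [isSub for @edges T].
HB.instance Definition _ (T : finType) := [Finite of sgraph T by <:].

Definition num_edges (T : finType) (G : sgraph T) : nat := #|edges G|.

Definition complete (T : finType) : sgraph T := SGraph (subxx (pairs T)).

(* The cycle C_t for t >= 3.  The intersection with [pairs] only matters for
   t = 1, where ordS i = i; the values at t < 3 are junk. *)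
Definition cycle_graph (t : nat) : sgraph 'I_t :=
  SGraph (subsetIr [set [set i; ordS i] | i : 'I_t] (pairs 'I_t)).

(* F contains a (not necessarily induced) copy of H. *)
Definition has_copy (S T : finType) (H : sgraph S) (F : sgraph T) : bool :=
  [exists f : {ffun S -> T},
     injectiveb f && [forall e in edges H, f @: e \in edges F]].

(* The subgraphs F of G range over spanning ones: deleting isolated vertices
   neither changes the number of edges nor the copies of an H which, like a
   cycle, has no isolated vertex. *)
Definition turan_ex (S T : finType) (G : sgraph T) (H : sgraph S) : nat :=
  \max_(F : sgraph T | (edges F \subset edges G) && ~~ has_copy H F)
     num_edges F.

Local Open Scope ring_scope.

Definition Gnp_weight (R : realType) (n : nat) (p : R) (G : sgraph 'I_n) : R :=
  \prod_(e in pairs 'I_n) (if e \in edges G then p else 1 - p).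

Definition Gnp_prob (R : realType) (n : nat) (p : R)
    (A : pred (sgraph 'I_n)) : R :=
  \sum_(G : sgraph 'I_n | A G) Gnp_weight p G.

(* Main.v *)
Require Import Defs.
From mathcomp Require Import all_boot all_order all_algebra.
From mathcomp Require Import reals sequences exp.
From mathcomp Require Import ring lra zify.

(* Let F be a subgraph of G(n, p) with more than the claimed number of edges.
   Partition the vertices into boundedly many classes so that most pairs of
   classes are either edgeless or "joined" (any two subsets of proportion at
   least 1/E span an edge); here the energy increment only counts edgeless
   pairs. Since e_G(A, B) <= (1 + o(1)) p |A| |B| for large A and B, the blow-up
   graph Gamma of the reduced graph has more than ex(n, C_t) edges, even after
   trimming a small fraction of each class and passing to a core of large
   minimum degree. So Gamma contains C_t, i.e. the reduced graph has a closed walk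
   of length t which visits no class more often than its trimmed size; no
   formula for ex(n, C_t) is needed.
   The walk is turned into a cycle of F of the same length. It is rearranged
   into stretches alternating between two classes, found by depth-first search.
   Consecutive stretches are linked by growing, inside a fresh reserved region
   which is an expander after cleaning, a tree of depth about log n / log (1/beta)
   and then walking in the reduced graph; once a link is chosen the rest of the
   tree is released, so that the waste does not accumulate over the (many)
   stretches. The parity of t is tracked in the bipartite double cover of the
   reduced graph. *)

Set Implicit Arguments.
Unset Strict Implicit.
Unset Printing Implicit Defensive.

(** * Paths inside a territory and depth-first search *)

(** A joined pair promises an edge only between subsets of linear size; a given vertex may have no
    neighbour at all. So every vertex to which the path is committed must be the root of a tree with
    linearly many leaves, and from one root to the next only sets are carried along; the vertices
    are chosen backwards, once the next root is known. The trees have arity above [1 / beta], which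
    is where [log (1/beta)] comes from. The closed walk may be rearranged because the visits to a
    class are accounted for half by the steps leaving it and half by the steps entering it. A
    stretch of as many steps as the walk makes from [i] to [j] is spread evenly over both classes,
    so all visit counts survive up to rounding. The number of stretches is then bounded in terms of
    the number of classes, and all links together have length O(log n), which fits into the trimmed
    part of every class. The random graph enters only through an upper bound on edges between large
    sets and a lower bound on their total number. *)

Section TerritoryPaths.
Variables (V : finType) (e : rel V).

(** The start [u] is exempt from the territory and from [uniq], so that paths are glued by
    disjointness of their territories alone; where a genuine path from [u] is needed, [u \notin T]
    is asked separately. *)
Definition tpath (T : {set V}) (l : nat) (u v : V) :=
  exists p, [/\ size p = l, path e u p, last u p = v, uniq p & {subset p <= T}].

Lemma tpath0 (T : {set V}) u : tpath T 0 u u.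
Proof. by exists [::]. Qed.

Lemma tpath_edge (T : {set V}) u v : e u v -> v \in T -> tpath T 1 u v.
Proof.
move=> uv vT; exists [:: v]; split=> //=; first by rewrite uv.
by move=> w; rewrite inE => /eqP->.
Qed.

Lemma tpath_sub (T T' : {set V}) l u v : T \subset T' -> tpath T l u v -> tpath T' l u v.
Proof.
move=> /subsetP sT [p [sz pp lp up sp]]; exists p; split=> // w /sp; exact: sT.
Qed.

Lemma tpath_cat (T1 T2 : {set V}) l1 l2 u v w : [disjoint T1 & T2] ->
  tpath T1 l1 u v -> tpath T2 l2 v w -> tpath (T1 :|: T2) (l1 + l2) u w.
Proof.
move=> dT [p [sp pp lp up subp]] [q [sq pq lq uq subq]].
exists (p ++ q); split.
- by rewrite size_cat sp sq.
- by rewrite cat_path pp lp.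
- by rewrite last_cat lp.
- rewrite cat_uniq up uq andbT; apply/hasPn => x /subq xT2.
  by apply/negP => /subp xT1; rewrite (disjointFr dT xT1) in xT2.
- by move=> x; rewrite mem_cat inE => /orP[/subp->|/subq->] //; rewrite orbT.
Qed.

Hypothesis esym : symmetric e.

Lemma tpath_cycle (T1 T2 : {set V}) l1 l2 u v w : u \notin T1 -> u \notin T2 ->
  [disjoint T1 & T2] -> tpath T1 l1 u v -> tpath T2 l2 u w -> e v w ->
  exists c, [/\ size c = (l1 + l2).+1, cycle e c & uniq c].
Proof.
move=> uT1 uT2 dT [p [sp pp lp up subp]] [q [sq pq lq uq subq]] vw.
exists (u :: p ++ rev q); split.
- by rewrite /= size_cat size_rev sp sq.
- rewrite /= rcons_cat cat_path pp lp /=.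
  have := rev_path e u q; rewrite lq.
  case: (lastP q) lq pq => [/= -> _ _ |q' x]; first by rewrite vw.
  rewrite last_rcons belast_rcons => -> pq.
  rewrite rev_rcons /= vw /= rev_cons => ->.
  by rewrite (eq_path (e':=e)) // => a b; rewrite esym.
- rewrite /= cat_uniq rev_uniq up uq andbT mem_cat mem_rev negb_or.
  apply/andP; split.
    by apply/andP; split; [apply: contra uT1 => /subp | apply: contra uT2 => /subq].
  rewrite andTb; apply/hasPn => x; rewrite mem_rev => /subq xT2.
  by apply/negP => /subp xT1; rewrite (disjointFr dT xT1) in xT2.
Qed.

End TerritoryPaths.

(** * Depth-first search for long alternating paths *)

Section AlternatingSearch.
Variables (V : finType) (e : rel V) (A B : {set V}).
Hypothesis dAB : [disjoint A & B].

Fixpoint alternates (b : bool) (p : seq V) : bool :=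
  if p is v :: q then (v \in (if b then A else B)) && alternates (~~ b) q
  else true.

Lemma alternates_rcons b p v :
  alternates b (rcons p v) =
  alternates b p && (v \in (if b (+) odd (size p) then A else B)).
Proof.
elim: p b => [|u p IH] b /=; first by rewrite addbF andbT.
by rewrite IH andbA; case: b; case: (odd _).
Qed.

Lemma alternates_sub b p : alternates b p -> {subset p <= A :|: B}.
Proof.
elim: p b => [|u p IH] b //= /andP[uAB /IH sp] v.
rewrite !inE => /orP[/eqP->|/sp]; last by rewrite inE.
by move: uAB; case: b => ->; rewrite ?orbT.
Qed.

Lemma alternates_countA b p : alternates b p ->
  count [in A] p = if b then uphalf (size p) else (size p)./2.
Proof.
elim: p b => [|u p IH] [] //= /andP[uX /IH ->]; rewrite ?uX /=; first by lia.
by rewrite (disjointFl dAB uX).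
Qed.

Lemma alternates_countB b p : alternates b p ->
  count [in B] p = if b then (size p)./2 else uphalf (size p).
Proof.
elim: p b => [|u p IH] [] //= /andP[uX /IH ->]; rewrite ?uX /=; last by lia.
by rewrite (disjointFr dAB uX).
Qed.

Lemma card_seq_setI (S : {set V}) p : uniq p -> #|S :&: [set v in p]| = count [in S] p.
Proof.
move=> up; rewrite -size_filter -(card_uniqP (filter_uniq _ up)).
by apply: eq_card => v; rewrite !inE mem_filter.
Qed.

Variables (X T : {set V}) (x ea eb : nat).
Hypotheses (dXA : [disjoint X & A]) (dXB : [disjoint X & B]).
Hypotheses (cardX : 2 * ea < #|X|) (cardA : x + 3 * ea <= #|A|)
  (cardB : x + 2 * eb <= #|B|).
Hypothesis edge_toB : forall D S : {set V}, D \subset X :|: A -> S \subset B ->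
  ea <= #|D| -> eb <= #|S| -> exists u v, [/\ u \in D, v \in S & e u v].
Hypothesis edge_toA : forall D S : {set V}, D \subset B -> S \subset A ->
  eb <= #|D| -> ea <= #|S| -> exists u v, [/\ u \in D, v \in S & e u v].
Hypothesis edge_toT : forall D : {set V}, D \subset X :|: A -> ea <= #|D| ->
  exists u v, [/\ u \in D, v \in T & e u v].

(* State of a depth-first search: the current path [x0 :: p], and the dead
   vertices, sorted by the side to which they failed to extend. *)
Record dfs_state (x0 : V) (p : seq V) (D1 D2 D3 : {set V}) : Prop := DfsState {
  dfs_root : x0 \in X;
  dfs_path : path e x0 p;
  dfs_alt : alternates false p;
  dfs_size : size p <= x.*2;
  dfs_uniq : uniq p;
  dfs_fresh : forall v, v \in x0 :: p -> v \notin D1 :|: D2 :|: D3;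
  dfs_D1 : D1 \subset X :|: A;
  dfs_D2 : D2 \subset B;
  dfs_D3 : D3 \subset X :|: A;
  dfs_card1 : #|D1| <= ea;
  dfs_card2 : #|D2| <= eb;
  dfs_card3 : #|D3| <= ea;
  dfs_dead1 : forall u v, u \in D1 -> v \in B -> v \notin D2 -> v \notin p ->
    ~~ e u v;
  dfs_dead2 : forall u v, u \in D2 -> v \in A -> v \notin D1 :|: D3 ->
    v \notin p -> ~~ e u v;
  dfs_dead3 : forall u v, u \in D3 -> v \in T -> ~~ e u v }.

(** A dead set that had reached its threshold would send an edge to the target [T] or to the
    opposite side minus path and dead vertices, against its being dead. The path takes at most [x]
    vertices of each side, so [cardA] and [cardB] leave a full threshold there. Strictness makes
    room for one more dead vertex. *)
Lemma dfs_card_bounds x0 p D1 D2 D3 : dfs_state x0 p D1 D2 D3 ->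
  [/\ #|D1| < ea, #|D2| < eb & #|D3| < ea].
Proof.
case=> _ _ ap sp up _ s1 s2 s3 c1 c2 c3 d1 d2 d3.
have cA := alternates_countA ap; have cB := alternates_countB ap.
have pA := card_seq_setI A up; have pB := card_seq_setI B up.
have UB : eb <= #|B :\: D2 :\: [set v in p]|.
  have := cardsID [set v in p] (B :\: D2); have := cardsID D2 B.
  have : #|(B :\: D2) :&: [set v in p]| <= #|B :&: [set v in p]|.
    by rewrite subset_leq_card // setSI // subsetDl.
  have : #|B :&: D2| <= #|D2| by rewrite subset_leq_card // subsetIr.
  by rewrite pB cB; clear -cardB c2 sp; lia.
have UA : ea <= #|A :\: (D1 :|: D3) :\: [set v in p]|.
  have := cardsID [set v in p] (A :\: (D1 :|: D3)); have := cardsID (D1 :|: D3) A.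
  have : #|(A :\: (D1 :|: D3)) :&: [set v in p]| <= #|A :&: [set v in p]|.
    by rewrite subset_leq_card // setSI // subsetDl.
  have : #|A :&: (D1 :|: D3)| <= #|D1| + #|D3|.
    by rewrite (leq_trans _ (leq_card_setU _ _)) // subset_leq_card // subsetIr.
  by rewrite pA cA; clear -cardA c1 c3 sp; lia.
split; rewrite ltnNge; apply/negP => big.
- have [|u [v [uD vS uv]]] := edge_toB s1 _ big UB.
    by rewrite (subset_trans (subsetDl _ _)) // subsetDl.
  move: vS; rewrite !inE => /and3P[vp vD vB].
  by rewrite (negPf (d1 u v uD vB vD vp)) in uv.
- have [|u [v [uD vS uv]]] := edge_toA s2 _ big UA.
    by rewrite (subset_trans (subsetDl _ _)) // subsetDl.
  move: vS; rewrite inE [_ \in A :\: _]inE inE => /and3P[vp vD vA].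
  by rewrite (negPf (d2 u v uD vA vD vp)) in uv.
- have [u [v [uD vT uv]]] := edge_toT s3 big.
  by rewrite (negPf (d3 u v uD vT)) in uv.
Qed.

Definition dfs_found := exists x0 p w,
  [/\ x0 \in X, path e x0 p, uniq p & size p = x.*2] /\
  [/\ {subset p <= A :|: B}, count [in A] p = x, count [in B] p = x,
      w \in T & e (last x0 p) w].

Lemma dfs_pop x0 p (D1 D2 D3 D1' D2' D3' : {set V}) :
  dfs_state x0 p D1 D2 D3 ->
  D1 \subset D1' -> D2 \subset D2' -> D3 \subset D3' ->
  D1' :|: D2' :|: D3' = last x0 p |: (D1 :|: D2 :|: D3) ->
  D1' \subset X :|: A -> D2' \subset B -> D3' \subset X :|: A ->
  #|D1'| <= ea -> #|D2'| <= eb -> #|D3'| <= ea ->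
  (forall u v, u \in D1' -> v \in B -> v \notin D2' -> v \notin p -> ~~ e u v) ->
  (forall u v, u \in D2' -> v \in A -> v \notin D1' :|: D3' -> v \notin p -> ~~ e u v) ->
  (forall u v, u \in D3' -> v \in T -> ~~ e u v) ->
  exists x1 q, dfs_state x1 q D1' D2' D3' /\ size p <= (size q).+1.
Proof.
case=> x0X pp ap sp up fp _ _ _ _ _ _ _ _ _ i1 i2 i3 DE s1 s2 s3 c1 c2 c3 d1 d2 d3.
have lastD : last x0 p \in D1' :|: D2' :|: D3' by rewrite DE setU11.
case: (lastP p) => [|q y] in pp ap sp up fp DE d1 d2 lastD *.
  have : 0 < #|X :\: (D1' :|: D3')|.
    have := cardsID (D1' :|: D3') X.
    have : #|X :&: (D1' :|: D3')| <= #|D1'| + #|D3'|.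
      by rewrite (leq_trans _ (leq_card_setU _ _)) // subset_leq_card // subsetIr.
    by clear -cardX c1 c3; lia.
  rewrite card_gt0 => /set0Pn[x1]; rewrite inE => /andP[x1D x1X].
  exists x1, [::]; split=> //; split=> // v; rewrite inE => /eqP->.
  rewrite setUAC inE negb_or x1D /=; apply/negP => /(subsetP s2).
  by rewrite (disjointFr dXB x1X).
rewrite last_rcons in DE lastD; rewrite rcons_path in pp.
rewrite alternates_rcons size_rcons rcons_uniq in ap sp up.
case/andP: pp ap up => [pq _] /andP[aq yAB] /andP[yq uq].
have yD : y \notin q by [].
have Aq v : v \in A -> v \notin D1' :|: D3' -> v \notin q -> v \notin rcons q y.
  move=> vA vD vq; rewrite mem_rcons inE negb_or vq andbT.
  apply: contra vD => /eqP vy; move: lastD; rewrite -vy setUAC inE => /orP[//|].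
  by move=> /(subsetP s2) vB; rewrite (disjointFr dAB vA) in vB.
have Bq v : v \in B -> v \notin D2' -> v \notin q -> v \notin rcons q y.
  move=> vB vD vq; rewrite mem_rcons inE negb_or vq andbT.
  apply: contra vD => /eqP vy; move: lastD; rewrite -vy setUAC inE => /orP[|//].
  by rewrite inE => /orP[/(subsetP s1)|/(subsetP s3)]; rewrite inE
    ?(disjointFl dXB vB) ?(disjointFl dAB vB).
exists x0, q; split; last by rewrite size_rcons.
split=> //; first exact: ltnW.
- move=> v vq; rewrite DE !inE negb_or.
  have vp : v \in x0 :: rcons q y by move: vq; rewrite !inE mem_rcons inE => /orP[->|->]; rewrite ?orbT.
  have := fp v vp; rewrite !inE => ->; rewrite andbT.
  move: vq; rewrite inE => /orP[/eqP->|]; last by apply: contraTneq => ->.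
  apply: contraTneq x0X => ->; move: yAB; case: (odd _) => /=.
    by move=> yA; rewrite (disjointFl dXA yA).
  by move=> yB; rewrite (disjointFl dXB yB).
- by move=> u v uD vB vD vq; apply: (d1 u v uD vB vD); apply: Bq.
- by move=> u v uD vA vD vq; apply: (d2 u v uD vA vD); apply: Aq.
Qed.

(** A dead vertex weighs two and a path vertex one: a push gains one, and a pop loses at most one
    while its dead vertex gains two. The potential is bounded, so the search must end in success. *)
Lemma dfs_progress x0 p D1 D2 D3 : dfs_state x0 p D1 D2 D3 ->
  dfs_found \/ exists x1 q D1' D2' D3', dfs_state x1 q D1' D2' D3' /\
    2 * (#|D1| + #|D2| + #|D3|) + size p <
    2 * (#|D1'| + #|D2'| + #|D3'|) + size q.
Proof.
move=> st; have [b1 b2 b3] := dfs_card_bounds st.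
have [x0X pp ap sp up fp s1 s2 s3 c1 c2 c3 d1 d2 d3] := st.
have topD : last x0 p \notin D1 :|: D2 :|: D3 by apply: fp; apply: mem_last.
have [t1 t2 t3] : [/\ last x0 p \notin D1, last x0 p \notin D2 & last x0 p \notin D3].
  by move: topD; rewrite !inE !negb_or -andbA => /and3P.
have top : last x0 p \in if odd (size p) then B else X :|: A.
  case: (lastP p) ap => [|q y] /=; first by rewrite inE x0X.
  rewrite alternates_rcons last_rcons size_rcons /= => /andP[_].
  by case: (odd _) => //=; rewrite inE => ->; rewrite orbT.
have pushable y : ~~ (size p == x.*2) -> y \in (if odd (size p) then A else B) ->
    y \notin p -> y \notin D1 :|: D2 :|: D3 -> e (last x0 p) y ->
    dfs_state x0 (rcons p y) D1 D2 D3.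
  move=> sz yAB yp yD ey; split=> //.
  - by rewrite rcons_path pp.
  - by rewrite alternates_rcons ap addFb.
  - by rewrite size_rcons ltn_neqAle sz.
  - by rewrite rcons_uniq yp.
  - move=> v; rewrite -rcons_cons mem_rcons inE => /orP[/eqP->//|]; exact: fp.
  - by move=> u v uD vB vD vp; apply: d1 => //; apply: contra vp; rewrite mem_rcons inE orbC => ->.
  - by move=> u v uD vB vD vp; apply: d2 => //; apply: contra vp; rewrite mem_rcons inE orbC => ->.
have push y : ~~ (size p == x.*2) -> y \in (if odd (size p) then A else B) ->
    y \notin p -> y \notin D1 :|: D2 :|: D3 -> e (last x0 p) y ->
  exists x1 q D1' D2' D3', dfs_state x1 q D1' D2' D3' /\
    2 * (#|D1| + #|D2| + #|D3|) + size p <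
    2 * (#|D1'| + #|D2'| + #|D3'|) + size q.
  move=> a1 a2 a3 a4 a5; exists x0, (rcons p y), D1, D2, D3; split; first exact: pushable.
  by rewrite size_rcons addnS.
case: (boolP (size p == x.*2)) => [/eqP szp|szp].
  case: (boolP [exists w in T, e (last x0 p) w]) => [/existsP[w /andP[wT ew]]|].
    left; exists x0, p, w; split; split=> //.
    - exact: alternates_sub ap.
    - by rewrite (alternates_countA ap) szp doubleK.
    - by rewrite (alternates_countB ap) szp uphalf_double.
  rewrite negb_exists => /forallP noT; right.
  have topXA : last x0 p \in X :|: A by move: top; rewrite szp odd_double.
  suff [x1 [q [st' szq]]] : exists x1 q, dfs_state x1 q D1 D2 (last x0 p |: D3) /\ size p <= (size q).+1.
    exists x1, q, D1, D2, (last x0 p |: D3); split=> //.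
    by rewrite cardsU1 t3 /=; clear -szq; lia.
  apply: (dfs_pop st) => //.
  - exact: subsetUr.
  - by rewrite setUCA.
  - by rewrite subUset sub1set topXA.
  - by rewrite cardsU1 t3.
  - move=> u v uD vA vD vp; apply: d2 => //; apply: contra vD.
    by rewrite !inE => /orP[->|->]; rewrite ?orbT.
  - move=> u v; rewrite inE => /orP[|uD vT]; last exact: d3.
    by rewrite inE => /eqP-> vT; have := noT v; rewrite vT.
case: (boolP [exists w, [&& w \in (if odd (size p) then A else B), w \notin p,
    w \notin D1 :|: D2 :|: D3 & e (last x0 p) w]]) => [/existsP[w /and4P[]]|].
  by move=> ? ? ? ?; right; apply: (push w).
rewrite negb_exists => /forallP stuck; right.
case: (boolP (odd (size p))) => [oddp|evenp].
  rewrite oddp in top stuck.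
  suff [x1 [q [st' szq]]] : exists x1 q, dfs_state x1 q D1 (last x0 p |: D2) D3 /\ size p <= (size q).+1.
    exists x1, q, D1, (last x0 p |: D2), D3; split=> //.
    by rewrite cardsU1 t2 /=; clear -szq; lia.
  apply: (dfs_pop st) => //.
  - exact: subsetUr.
  - by rewrite (setUCA D1) !setUA.
  - by rewrite subUset sub1set top.
  - by rewrite cardsU1 t2.
  - move=> u v uD vA vD vp; apply: d1 => //; apply: contra vD.
    by rewrite !inE => ->; rewrite ?orbT.
  - move=> u v; rewrite inE => /orP[|uD vA vD vp]; last exact: d2.
    rewrite inE => /eqP-> vA vD vp; apply/negP => uv.
    have := stuck v; rewrite vA vp uv andbT /= negbK setUAC inE (negPf vD) /=.
    by move=> /(subsetP s2) vB; rewrite (disjointFr dAB vA) in vB.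
rewrite (negPf evenp) in top stuck.
suff [x1 [q [st' szq]]] : exists x1 q, dfs_state x1 q (last x0 p |: D1) D2 D3 /\ size p <= (size q).+1.
  exists x1, q, (last x0 p |: D1), D2, D3; split=> //.
  by rewrite cardsU1 t1 /=; clear -szq; lia.
apply: (dfs_pop st) => //.
- exact: subsetUr.
- by rewrite !setUA.
- by rewrite subUset sub1set top.
- by rewrite cardsU1 t1.
- move=> u v; rewrite inE => /orP[|uD vB vD vp]; last exact: d1.
  rewrite inE => /eqP-> vB vD vp; apply/negP => uv.
  have := stuck v; rewrite vB vp uv andbT /= negbK setUAC inE (negPf vD) orbF.
  rewrite inE => /orP[/(subsetP s1)|/(subsetP s3)]; rewrite inE
    ?(disjointFl dXB vB) ?(disjointFl dAB vB) //.
- move=> u v uD vA vD vp; apply: d2 => //; apply: contra vD.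
  by rewrite !inE => /orP[->|->]; rewrite ?orbT.
Qed.

Lemma alternating_search : dfs_found.
Proof.
have [x0 x0X] : exists x0, x0 \in X.
  by apply/set0Pn; rewrite -card_gt0; apply: leq_ltn_trans cardX.
have start : dfs_state x0 [::] set0 set0 set0.
  by split; rewrite ?sub0set ?cards0 //= => v; rewrite ?inE.
suff run m y q D1 D2 D3 : dfs_state y q D1 D2 D3 ->
    2 * (ea + eb + ea) + x.*2 - (2 * (#|D1| + #|D2| + #|D3|) + size q) <= m ->
    dfs_found by apply: run start (leqnn _).
elim: m y q D1 D2 D3 => [|m IH] y q D1 D2 D3 st le_m;
  have [//|[y' [q' [D1' [D2' [D3' [st' lt]]]]]]] := dfs_progress st.
  have [_ _ _ sq _ _ _ _ _ c1 c2 c3 _ _ _] := st'.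
  by exfalso; clear - le_m lt sq c1 c2 c3; lia.
have [_ _ _ sq _ _ _ _ _ c1 c2 c3 _ _ _] := st'.
by apply: IH st' _; clear - le_m lt sq c1 c2 c3; lia.
Qed.

End AlternatingSearch.

(** * Vertex classes and the reduced graph *)

Lemma exists_subset_card (T : finType) (S : {set T}) k : k <= #|S| ->
  exists2 S' : {set T}, S' \subset S & #|S'| = k.
Proof.
move=> le_k; exists [set x in take k (enum S)].
  by apply/subsetP => x; rewrite inE => /mem_take; rewrite mem_enum.
rewrite cardsE; have /card_uniqP-> : uniq (take k (enum S)) by rewrite take_uniq ?enum_uniq.
by rewrite size_takel // -cardE.
Qed.

Section Classes.
Variables (V K : finType) (adj : rel V) (chi : V -> K).

Definition cls i : {set V} := [set v | chi v == i].

Lemma sum_card_cls (S : {set V}) : \sum_i #|S :&: cls i| = #|S|.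
Proof.
rewrite -sum1_card (partition_big chi xpredT) //=; apply: eq_bigr => i _.
by rewrite sum1_card; apply: eq_card => v; rewrite !inE.
Qed.

Lemma sum_card_cls_le (P : pred K) (S : {set V}) :
  \sum_(i | P i) #|S :&: cls i| <= #|S|.
Proof. by rewrite -[leqRHS]sum_card_cls [leqRHS](bigID P) /= leq_addr. Qed.

Definition joined E i j := forall A B : {set V}, A \subset cls i ->
  B \subset cls j -> #|cls i| <= E * #|A| -> #|cls j| <= E * #|B| ->
  exists u v, [/\ u \in A, v \in B & adj u v].

Variables (R : rel K) (E : nat).
Hypotheses (E_gt0 : 0 < E) (R_joined : forall i j, R i j -> joined E i j).

Definition class_threshold i := (#|cls i| %/ E).+1.

Definition class_adj u v := adj u v && R (chi u) (chi v).

Lemma thrE i (A : {set V}) : class_threshold i <= #|A| -> #|cls i| <= E * #|A|.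
Proof.
move=> le_A; apply: leq_trans (ltnW (ltn_ceil _ E_gt0)) _.
by rewrite mulnC leq_mul2l le_A orbT.
Qed.

Lemma joined_thr i j (A B : {set V}) : R i j -> A \subset cls i ->
  B \subset cls j -> class_threshold i <= #|A| -> class_threshold j <= #|B| ->
  exists u v, [/\ u \in A, v \in B & class_adj u v].
Proof.
move=> Rij sA sB cA cB.
have [u [v [uA vB uv]]] := R_joined Rij sA sB (thrE cA) (thrE cB).
exists u, v; split=> //; rewrite /class_adj uv.
by have := subsetP sA u uA; have := subsetP sB v vB; rewrite !inE => /eqP-> /eqP->.
Qed.

(** The vertices of [S] without a neighbour in [X] span no edge with [X], so by joinedness they are
    fewer than a threshold. *)
Lemma nbr_card_gt i j (X S : {set V}) : R i j -> X \subset cls i ->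
  class_threshold i <= #|X| -> S \subset cls j ->
  #|S| < #|[set y in S | [exists x in X, class_adj x y]]| + class_threshold j.
Proof.
move=> Rij sX cX sS; set Y := [set y in S | _].
rewrite -(cardsID Y S) (setIidPr _); last by apply/subsetP => y; rewrite inE => /andP[].
rewrite ltn_add2l ltnNge; apply/negP => big.
have [|x [y [xX]]] := joined_thr Rij sX _ cX big.
  exact: subset_trans (subsetDl _ _) sS.
rewrite !inE => /andP[nY yS] xy; case/negP: nY; rewrite yS.
by apply/existsP; exists x; rewrite xX.
Qed.

Definition double_cover (a b : K * bool) := R a.1 b.1 && (a.2 != b.2).

Lemma path_dcover u p s : path class_adj u p ->
  connect double_cover (chi u, s) (chi (last u p), s (+) odd (size p)).
Proof.
elim: p u s => [|v p IH] u s /=; first by rewrite addbF connect0.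
case/andP=> /andP[_ uv] /(IH _ (~~ s)) c.
apply: (connect_trans (y := (chi v, ~~ s))).
  by apply: connect1; rewrite /double_cover uv; case: s {c}.
by move: c; rewrite addNb addbN.
Qed.

Lemma tpath_dcover (T : {set V}) l u v s : tpath class_adj T l u v ->
  connect double_cover (chi u, s) (chi v, s (+) odd l).
Proof. by case=> p [<- pp <- _ _]; apply: path_dcover. Qed.

Lemma connect_dcover_flip a b : connect double_cover a b ->
  connect double_cover (a.1, ~~ a.2) (b.1, ~~ b.2).
Proof.
case/connectP => p pp ->; elim: p a pp => [|c p IH] a /=; first by rewrite connect0.
case/andP => /andP[ac1 ac2] /IH; apply: connect_trans; apply: connect1.
by rewrite /double_cover ac1; move: ac2; case: (a.2); case: (c.2).
Qed.

(** Each step enters a reserved set of four thresholds and misses less than one of them, so three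
    survive. Distinct nodes of [p] own disjoint reserved sets, hence a path traced back from a
    vertex of [Y] repeats none. *)
Lemma set_walk (S : K * bool -> {set V}) (p : seq (K * bool)) a (X : {set V}) :
  path double_cover a p -> uniq p -> X \subset cls a.1 -> 3 * class_threshold a.1 <= #|X| ->
  {in p, forall q, S q \subset cls q.1 /\ 4 * class_threshold q.1 <= #|S q|} ->
  (forall q q', q != q' -> [disjoint S q & S q']) ->
  exists Y : {set V}, [/\ Y \subset cls (last a p).1, 3 * class_threshold (last a p).1 <= #|Y| &
    {in Y, forall y, exists2 x, x \in X &
       tpath class_adj (\bigcup_(q in p) S q) (size p) x y}].
Proof.
elim: p a X => [|b p IH] a X /=.
  by move=> _ _ sX cX _ _; exists X; split=> // y yX; exists y => //; exact: tpath0.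
case/andP => /andP[ab _] pp /andP[bp up] sX cX hS dS.
have [sS cS] := hS b (mem_head _ _).
pose X1 := [set y in S b | [exists x in X, class_adj x y]].
have sX1 : X1 \subset S b by apply/subsetP => y; rewrite inE => /andP[].
have cX1 : 3 * class_threshold b.1 <= #|X1|.
  have := nbr_card_gt ab sX (leq_trans (leq_pmull _ _) cX) sS.
  by rewrite -/X1 => lt; have := cS; clear -lt; lia.
have [|Y [sY cY hY]] := IH b X1 pp up (subset_trans sX1 sS) cX1 _ dS.
  by move=> q qp; apply: hS; rewrite inE qp orbT.
exists Y; split=> // y /hY[x1 x1X1 t1].
have [x1S /existsP[x /andP[xX xx1]]] : x1 \in S b /\ [exists x in X, class_adj x x1].
  by move: x1X1; rewrite inE => /andP[].
exists x => //; rewrite -add1n.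
have dT : [disjoint [set x1] & \bigcup_(q in p) S q].
  rewrite disjoints1; apply/negP => /bigcupP[q qp x1q].
  have bq : b != q by apply: contraNneq bp => ->.
  by rewrite (disjointFr (dS _ _ bq) x1S) in x1q.
apply: tpath_sub (tpath_cat dT (tpath_edge xx1 (set11 x1)) t1).
apply/subsetP => v; rewrite inE => /orP[|/bigcupP[q qp vq]].
  by rewrite inE => /eqP->; apply/bigcupP; exists b; rewrite ?mem_head.
by apply/bigcupP; exists q; rewrite // inE qp orbT.
Qed.

Definition live : {set K} := [set i | [exists j, R i j]].

Lemma live_src i j : R i j -> i \in live.
Proof. by move=> Rij; rewrite inE; apply/existsP; exists j. Qed.

Definition liveV : {set V} := [set v | chi v \in live].

Lemma exists_quota (Fr : {set V}) (s : K -> nat) :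
  {in live, forall i, s i <= #|Fr :&: cls i|} ->
  exists S : {set V}, [/\ S \subset Fr, S \subset liveV &
    {in live, forall i, #|S :&: cls i| = s i}].
Proof.
move=> hs; have /fin_all_exists[f fP] : forall i, exists S : {set V},
    i \in live -> S \subset Fr :&: cls i /\ #|S| = s i.
  move=> i; case: (boolP (i \in live)) => [il|_]; last by exists set0.
  by have [S sS cS] := exists_subset_card (hs i il); exists S.
have fcls i : i \in live -> {subset f i <= cls i}.
  by move=> /fP[/subsetP si _] v /si; rewrite inE => /andP[].
exists (\bigcup_(i in live) f i); split.
- by apply/bigcupsP => i /fP[/subset_trans-> //]; exact: subsetIl.
- apply/bigcupsP => i il; apply/subsetP => v /(fcls _ il).
  by rewrite !inE => /eqP->; rewrite inE in il.
- move=> i il; have [sf <-] := fP i il; apply: eq_card => v.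
  rewrite inE; apply/andP/idP => [[/bigcupP[j jl vj]]|vf].
    by have := fcls j jl v vj; rewrite !inE => /eqP-> /eqP<-.
  by split; [apply/bigcupP; exists i | exact: fcls vf].
Qed.

Lemma pigeonhole_cls c (L : {set V}) : L \subset liveV -> 0 < #|L| ->
  c * #|V| <= E * #|L| -> exists2 i, i \in live & c * #|cls i| <= E * #|L :&: cls i|.
Proof.
move=> sL L0 cL; apply/exists_inP; apply: contraTT cL => /exists_inPn no.
have liveL : \sum_(i in live) #|L :&: cls i| = #|L|.
  rewrite -[RHS]sum_card_cls [RHS](bigID [in live]) /= [X in _ = _ + X]big1 ?addn0 //.
  move=> i il; apply: eq_card0 => v; rewrite !inE; apply/negP => /andP[/(subsetP sL)].
  by rewrite inE => vl /eqP vi; rewrite -vi vl in il.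
have live0 : 0 < #|live|.
  case/card_gt0P: L0 => v /(subsetP sL); rewrite inE => vl.
  by apply/card_gt0P; exists (chi v).
rewrite -ltnNge -liveL big_distrr /=.
have le1 : \sum_(i in live) (E * #|L :&: cls i|).+1 <= \sum_(i in live) c * #|cls i|.
  by apply: leq_sum => i /no; rewrite -ltnNge.
have le2 : \sum_(i in live) #|cls i| <= #|V|.
  rewrite -[leqRHS]cardsT; apply: leq_trans (sum_card_cls_le [in live] [set: V]).
  by apply: leq_sum => i _; rewrite setTI.
have le3 : \sum_(i in live) c * #|cls i| <= c * #|V| by rewrite -big_distrr leq_mul2l le2 orbT.
apply: leq_trans le3; apply: leq_trans le1.
under [leqRHS]eq_bigr do rewrite -addn1.
by rewrite big_split /= sum1_card -addn1 leq_add2l.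
Qed.

End Classes.

(** * Expansion inside a reserved region *)

Section Expansion.
Variables (V K : finType) (adj : rel V) (chi : V -> K) (R : rel K) (E : nat).
Hypotheses (E_gt0 : 0 < E)
  (R_joined : forall i j, R i j -> joined adj chi E i j).
Local Notation cls := (cls chi).
Local Notation thr := (class_threshold chi E).
Local Notation live := (live R).
Local Notation liveV := (liveV chi R).
Local Notation adjR := (class_adj adj chi R).
Variables (y w d : nat).
Hypotheses (V_gt0 : 0 < #|V|) (d_ge2 : 2 <= d)
  (E_large : 24 * w * y * (d + 3) < E).
Hypothesis R_degree : {in live, forall i, #|V| <= y * \sum_(j | R i j) #|cls j|}.
Hypothesis cls_large : {in live, forall i, E <= #|cls i| /\ 2 * w * thr i <= #|cls i|}.
Hypothesis R_sym : symmetric R.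
Variable N : {set V}.
Hypotheses (N_live : N \subset liveV)
  (N_dense : {in live, forall i, #|cls i| <= w * #|N :&: cls i|}).

Definition nb (S : {set V}) : {set V} := [set v in N | [exists u in S, adjR u v]].

(** In every class [j] related to [i], all but a threshold of [N :&: cls j] is reached. The
    threshold is at most half of that set by [cls_large] and [N_dense], and [R_degree] sums over
    [j]. *)
Lemma nb_large (U : {set V}) i : i \in live -> thr i <= #|U :&: cls i| ->
  #|V| <= 2 * w * y * #|nb U|.
Proof.
move=> il cU; apply: leq_trans (R_degree il) _.
have <- : y * (2 * w * #|nb U|) = 2 * w * y * #|nb U| by clear; lia.
rewrite leq_mul2l; apply/orP; right.
apply: leq_trans (_ : 2 * w * \sum_(j | R i j) #|nb U :&: cls j| <= _); last first.
  by rewrite leq_mul2l sum_card_cls_le orbT.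
rewrite big_distrr /=; apply: leq_sum => j Rij.
have jl : j \in live by apply: (live_src (j := i)); rewrite R_sym.
have [_ c2] := cls_large jl; have c1 := N_dense jl.
have := nbr_card_gt E_gt0 R_joined Rij (subsetIr U (cls i)) cU (subsetIr N (cls j)).
set Y := [set _ in _ | _].
have sY : #|Y| <= #|nb U :&: cls j|.
  apply/subset_leq_card/subsetP => v; rewrite !inE => /andP[/andP[-> ->]] /existsP[u].
  rewrite inE => /andP[/andP[uU _] uv]; rewrite andbT /=.
  by apply/existsP; exists u; rewrite uU.
move=> lt; have le1 : #|N :&: cls j| <= #|nb U :&: cls j| + thr j.
  by apply: leq_trans (ltnW lt) _; rewrite leq_add2r.
have le2 : 2 * w * #|N :&: cls j| <= 2 * w * (#|nb U :&: cls j| + thr j).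
  by rewrite leq_mul2l le1 orbT.
by move: le2; rewrite mulnDr; clear - c1 c2; lia.
Qed.

(** [U] is a largest non-expanding set of size at most [12 * #|V| / E]. If it had half that size,
    some class would contain a threshold of it, and [nb_large] would give it more neighbours than
    [E_large] permits. A small non-expanding [S] outside [U] could therefore be merged into [U]
    without exceeding the size limit, against maximality. *)
Lemma exists_expander : exists U : {set V}, [/\ U \subset N, E * #|U| < 6 * #|V| &
  forall S : {set V}, S \subset N :\: U -> 0 < #|S| -> E * #|S| <= 6 * #|V| ->
    (d + 2) * #|S| < #|nb S :\: U :\: S|].
Proof.
pose P (U : {set V}) :=
  [&& U \subset N, E * #|U| <= 12 * #|V| & #|nb U :\: U| <= (d + 2) * #|U|].
have P0 : P set0.
  rewrite /P sub0set cards0 !muln0 /= leqn0 cards_eq0; apply/eqP/setP => v.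
  rewrite !inE /=; apply/negP => /andP[_ /existsP[u]]; by rewrite inE.
case: (arg_maxnP (fun U : {set V} => #|U|) P0) => U /and3P[sU cU nU] maxU.
have small : E * #|U| < 6 * #|V|.
  rewrite ltnNge; apply/negP => big.
  have U0 : 0 < #|U| by move: big; case: #|U| => [|//]; rewrite muln0; clear -V_gt0; lia.
  have [i il ci] := pigeonhole_cls (subset_trans sU N_live) U0 big.
  have thri : thr i <= #|U :&: cls i|.
    rewrite -(leq_pmul2l E_gt0) mulnS mulnC.
    by have := leq_divM #|cls i| E; have [c1 _] := cls_large il; clear - ci c1; lia.
  have le1 := nb_large il thri.
  have le2 : #|nb U| <= (d + 3) * #|U|.
    rewrite -(cardsID U (nb U)).
    have : #|nb U :&: U| <= #|U| by rewrite subset_leq_card // subsetIr.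
    by clear -nU; lia.
  have : E * #|V| <= 24 * w * y * (d + 3) * #|V|.
    apply: leq_trans (_ : E * (2 * w * y * ((d + 3) * #|U|)) <= _).
      by rewrite leq_mul2l (leq_trans le1) ?orbT // leq_mul2l le2 orbT.
    have -> : E * (2 * w * y * ((d + 3) * #|U|)) = 2 * w * y * (d + 3) * (E * #|U|) by clear; lia.
    have -> : 24 * w * y * (d + 3) * #|V| = 2 * w * y * (d + 3) * (12 * #|V|) by clear; lia.
    by rewrite leq_mul2l cU orbT.
  by rewrite leq_pmul2r // leqNgt E_large.
exists U; split=> // S sS S0 cS; rewrite ltnNge; apply/negP => bad.
have dis : [disjoint U & S].
  by rewrite disjoint_sym; apply: disjointWl sS _; rewrite disjoints_subset subsetDr.
have cUS : #|U :|: S| = #|U| + #|S| by rewrite cardsU (disjoint_setI0 dis) cards0 subn0.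
have : #|U :|: S| <= #|U|.
  apply: maxU; apply/and3P; split.
  - by rewrite subUset sU (subset_trans sS) ?subsetDl.
  - by rewrite cUS mulnDr; clear -small cS; lia.
  - rewrite cUS mulnDr; apply: leq_trans (leq_add nU bad).
    apply: leq_trans (leq_card_setU _ _); apply/subset_leq_card/subsetP => v.
    rewrite !inE negb_or -!andbA => /and4P[vU vS vN /existsP[u]].
    rewrite inE => /andP[/orP[uU|uS] uv].
      by apply/orP; left; rewrite vU vN; apply/existsP; exists u; rewrite uU.
    by apply/orP; right; rewrite vU vS vN; apply/existsP; exists u; rewrite uS.
by rewrite cUS; clear -S0; lia.
Qed.

(** The last level has [d ^ s] vertices and the whole tree at most twice as many. Of the more than
    [(d + 2) * d ^ s] new neighbours at most [2 * d ^ s] lie in the tree, so [d ^ s.+1] fresh ones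
    remain for the next level. *)
Lemma grow_tree (U : {set V}) z s : z \in N :\: U ->
  (forall S : {set V}, S \subset N :\: U -> 0 < #|S| -> E * #|S| <= 6 * #|V| ->
    (d + 2) * #|S| < #|nb S :\: U :\: S|) ->
  (forall r, r < s -> E * d ^ r <= 6 * #|V|) ->
  exists L T : {set V}, [/\ L \subset T, T \subset N :\: U, #|L| = d ^ s &
    [/\ #|T| <= 2 * d ^ s, z \in T & {in L, forall v, tpath adjR (T :\ z) s z v}]].
Proof.
move=> zN expand; elim: s => [|s IH] hs.
  exists [set z], [set z]; rewrite cards1 expn0; split=> //; first by rewrite sub1set.
  by split=> //; [rewrite set11 | move=> v; rewrite inE => /eqP->; exact: tpath0].
have [|L [T [sLT sT cL [cT zT hL]]]] := IH; first by move=> r rs; apply: hs; exact: ltnW.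
have ds0 : 0 < d ^ s by rewrite expn_gt0; case: (d) d_ge2.
have := expand L (subset_trans sLT sT); rewrite cL => /(_ ds0 (hs s (ltnSn s))) big.
have : d ^ s.+1 <= #|nb L :\: U :\: T|.
  have := cardsID T (nb L :\: U :\: L).
  have -> : (nb L :\: U :\: L) :\: T = nb L :\: U :\: T by rewrite setDDl (setUidPr sLT).
  have : #|(nb L :\: U :\: L) :&: T| <= #|T| by rewrite subset_leq_card // subsetIr.
  by rewrite expnS; move: big; rewrite mulnDl; clear -cT; lia.
case/exists_subset_card => L' sL' cL'.
have dLT : forall v, v \in L' -> v \notin T by move=> v /(subsetP sL'); rewrite !inE => /andP[].
exists L', (T :|: L'); split=> //.
- exact: subsetUr.
- rewrite subUset sT; apply: subset_trans sL' _; rewrite setDDl; apply/subsetP => v.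
  by rewrite !inE negb_or -!andbA => /and4P[-> _ -> _].
- split.
    apply: leq_trans (leq_card_setU _ _) _; rewrite cL' expnS.
    have : 2 * d ^ s <= d * d ^ s by rewrite leq_mul2r d_ge2 orbT.
    by clear -cT; lia.
  - by rewrite inE zT.
  - move=> v vL'; have := subsetP sL' v vL'.
    rewrite !inE => /and4P[vT vU vN /existsP[u /andP[uL uv]]].
    have vz : v != z by apply: contraNneq vT => ->.
    rewrite -addn1; have dT : [disjoint T :\ z & [set v]].
      by rewrite disjoint_sym disjoints1 !inE (negPf vT) andbF.
    apply: tpath_sub (tpath_cat dT (hL u uL) (tpath_edge uv (set11 v))).
    rewrite subUset sub1set; apply/andP; split; first exact: setSD (subsetUl _ _).
    by rewrite !inE vz vL' orbT.
Qed.

(** What makes a region usable for a link: from every live class a set of threshold size has an edge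
    into [Ns], and every vertex of [Ns] so reached grows into a set large enough to walk on with
    [set_walk]. *)
Lemma exists_rich h : (forall r, r < h -> E * d ^ r <= 6 * #|V|) ->
  6 * #|V| <= E * d ^ h ->
  exists Ns : {set V}, [/\ Ns \subset N,
    {in live, forall i, exists2 j, R i j & thr j <= #|Ns :&: cls j|} &
    {in Ns, forall z, exists (j : K) (L : {set V}), [/\ L \subset cls j,
       3 * thr j <= #|L| & {in L, forall v, tpath adjR (N :\ z) h z v}]}].
Proof.
move=> h1 h2; have [U [sU cU expand]] := exists_expander.
exists (N :\: U); split; first exact: subsetDl.
- move=> i il; apply/exists_inP; apply/contraT => /exists_inPn no.
  have : #|V| <= 2 * w * y * #|U|.
    apply: leq_trans (R_degree il) _.
    have -> : 2 * w * y * #|U| = y * (2 * w * #|U|) by clear; lia.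
    rewrite leq_mul2l; apply/orP; right.
    apply: leq_trans (_ : 2 * w * \sum_(j | R i j) #|U :&: cls j| <= _); last first.
      by rewrite leq_mul2l sum_card_cls_le orbT.
    rewrite big_distrr /=; apply: leq_sum => j Rij.
    have jl : j \in live by apply: (live_src (j := i)); rewrite R_sym.
    have [_ c2] := cls_large jl; have c1 := N_dense jl.
    have := no j Rij; rewrite -ltnNge => lt.
    have le1 : #|N :&: cls j| <= #|U :&: cls j| + thr j.
      have := cardsID U (N :&: cls j).
      have -> : (N :&: cls j) :\: U = (N :\: U) :&: cls j by rewrite setIDAC.
      have : #|(N :&: cls j) :&: U| <= #|U :&: cls j|.
        by rewrite subset_leq_card // setIAC setSI // subsetIr.
      by clear -lt; lia.
    have le2 : 2 * w * #|N :&: cls j| <= 2 * w * (#|U :&: cls j| + thr j).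
      by rewrite leq_mul2l le1 orbT.
    by move: le2; rewrite mulnDr; clear - c1 c2; lia.
  rewrite leqNgt => /negP[]; rewrite -(ltn_pmul2l E_gt0).
  have le3 : 2 * w * y * (E * #|U|) <= 2 * w * y * (6 * #|V|).
    by rewrite leq_mul2l (ltnW cU) orbT.
  have le4 : 24 * w * y * #|V| <= 24 * w * y * (d + 3) * #|V|.
    by rewrite leq_mul2r leq_pmulr ?orbT // addn3.
  have lt5 : 24 * w * y * (d + 3) * #|V| < E * #|V| by rewrite ltn_pmul2r.
  by move: (leq_ltn_trans le4 lt5) le3; clear; lia.
- move=> z zN; have [L [T [sLT sT cL [cT zT hL]]]] := grow_tree zN expand h1.
  have sTN : T \subset N by apply: subset_trans sT (subsetDl _ _).
  have L0 : 0 < #|L| by rewrite cL expn_gt0; case: (d) d_ge2.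
  (* A threshold is at most [2 * #|cls i| / E] since [E <= #|cls i|], so a proportion [6 / E]
     contains three thresholds. *)
  have [|i il ci] := pigeonhole_cls (E := E) (c := 6) (subset_trans sLT (subset_trans sTN N_live)) L0.
    by rewrite cL.
  exists i, (L :&: cls i); split; first exact: subsetIr.
    rewrite -(leq_pmul2l E_gt0).
    have := leq_divM #|cls i| E; have [c1 _] := cls_large il.
    by rewrite /class_threshold; clear - ci c1; lia.
  by move=> v; rewrite inE => /andP[/hL t _]; apply: tpath_sub t; apply: setSD.
Qed.
End Expansion.

(** * Routing through the reduced graph *)

Section Routing.
Variables (V K : finType) (adj : rel V) (chi : V -> K) (R : rel K) (E : nat).
Hypotheses (E_gt0 : 0 < E)
  (R_joined : forall i j, R i j -> joined adj chi E i j).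
Local Notation cls := (cls chi).
Local Notation thr := (class_threshold chi E).
Local Notation live := (live R).
Local Notation liveV := (liveV chi R).
Local Notation adjR := (class_adj adj chi R).
Local Notation dcover := (double_cover R).
Hypothesis R_sym : symmetric R.

Lemma exists_quota_rest (Fr : {set V}) (s r : K -> nat) :
  {in live, forall i, s i + r i <= #|Fr :&: cls i|} ->
  exists S : {set V}, [/\ S \subset Fr, S \subset liveV,
    {in live, forall i, #|S :&: cls i| = s i} &
    {in live, forall i, r i <= #|(Fr :\: S) :&: cls i|}].
Proof.
move=> hsr; have [|S [sF sl hS]] := @exists_quota V K chi R Fr s.
  by move=> i /hsr; apply: leq_trans; apply: leq_addr.
exists S; split=> // i il; have := hsr i il.
have := cardsID S (Fr :&: cls i); rewrite setIAC (setIidPr sF) (hS i il).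
have -> : (Fr :&: cls i) :\: S = (Fr :\: S) :&: cls i by rewrite setIDAC.
by move=> <-; rewrite leq_add2l.
Qed.

Lemma tpath_end (T : {set V}) l u v : tpath adjR T l u v -> v \in u |: T.
Proof.
case=> p [_ _ <- _ sp]; case: (lastP p) sp => [|q x] sp; first exact: setU11.
by rewrite last_rcons inE sp ?orbT // mem_rcons mem_head.
Qed.

Lemma dcover_sym : symmetric dcover.
Proof. by move=> a b; rewrite /double_cover R_sym eq_sym. Qed.

Lemma path_dcover_live a p : path dcover a p -> {in p, forall q, q.1 \in live}.
Proof.
elim: p a => [|b p IH] a //= /andP[/andP[ab _] pp] q; rewrite inE => /orP[/eqP->|].
  by apply: (live_src (j := a.1)); rewrite R_sym.
exact: IH pp q.
Qed.

(** A simple path in the double cover meets each class at most once per layer. Two disjoint reserves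
    of four thresholds, [S0] and [S1], serve the two layers, and the layers of the endpoints dictate
    the parity of the length. *)
Lemma walk_to (Fr : {set V}) j (X : {set V}) a s s' : X \subset cls j ->
  3 * thr j <= #|X| -> connect dcover (j, s) (a, s') ->
  {in live, forall i, 8 * thr i <= #|Fr :&: cls i|} ->
  exists l (Y : {set V}), [/\ l <= 2 * #|K|, odd l = s (+) s',
    Y \subset cls a, 3 * thr a <= #|Y| &
    {in Y, forall y, exists2 x, x \in X & tpath adjR Fr l x y}].
Proof.
move=> sX cX /connectP[p0 /shortenP[p pp up _] lp] hFr.
have [|S0 [sS0 _ cS0 rS0]] := @exists_quota_rest Fr (fun i => 4 * thr i) (fun i => 4 * thr i).
  by move=> i il; rewrite -mulnDl hFr.
have [|S1 [sS1 _ cS1]] := @exists_quota V K chi R (Fr :\: S0) (fun i => 4 * thr i).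
  by move=> i il; apply: rS0.
pose S (q : K * bool) := (if q.2 then S1 else S0) :&: cls q.1.
have dS01 : [disjoint S0 & S1].
  by rewrite disjoint_sym disjoints_subset (subset_trans sS1) // subsetDr.
have dS q q' : q != q' -> [disjoint S q & S q'].
  move=> qq'; rewrite -setI_eq0; apply/eqP/setP => v; rewrite !inE.
  apply/negP => /andP[/andP[vS /eqP e1] /andP[vS' /eqP e2]].
  case/negP: qq'; move: q q' vS e1 vS' e2 => [i b] [i' b'] /= vS e1 vS' e2.
  rewrite -e1 -e2 xpair_eqE eqxx /=.
  by move: vS vS'; case: b; case: b' => // v1 v2; rewrite (disjointFr dS01 _) in v2 || rewrite (disjointFr dS01 v2) in v1.
have hS : {in p, forall q, S q \subset cls q.1 /\ 4 * thr q.1 <= #|S q|}.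
  move=> q /(path_dcover_live pp) ql; rewrite /S; split; first exact: subsetIr.
  by case: (q.2); rewrite ?cS1 ?cS0.
have [Y [sY cY hY]] := set_walk E_gt0 R_joined pp (andP up).2 sX cX hS dS.
rewrite -lp in sY cY.
exists (size p), Y; split=> //.
- have : #|(j, s) :: p| <= #|{: K * bool}| by apply: max_card.
  rewrite (card_uniqP up) card_prod card_bool mulnC /= => /ltnW; exact.
- have : forall c q, path dcover c q -> (last c q).2 = c.2 (+) odd (size q).
    move=> c q; elim: q c => [|b q IH] c /=; first by rewrite addbF.
    case/andP => /andP[_ cb] /IH ->; move: cb.
    by case: (c.2); case: (b.2); case: (odd _).
  by move=> /(_ _ _ pp); rewrite -lp /= => ->; case: (s); case: (odd _).
- move=> y /hY[x xX t]; exists x => //; apply: tpath_sub t.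
  apply/bigcupsP => q _; apply: subset_trans (subsetIl _ _) _.
  by case: (q.2) => //; apply: subset_trans sS1 (subsetDl _ _).
Qed.

Variable h : nat.

Definition leafy (N : {set V}) z := exists (j : K) (L : {set V}),
  [/\ L \subset cls j, 3 * thr j <= #|L| &
      {in L, forall v, tpath adjR (N :\ z) h z v}].

(** The class [j] of the leaves is not under control, but the tree path is itself a walk in the
    double cover. So the walk that starts at [j] in layer [s (+) odd h] can still reach [(a, s')],
    and the total parity is as prescribed. *)
Lemma approach (N Fr : {set V}) z a s s' : leafy N z -> [disjoint N & Fr] ->
  connect dcover (chi z, s) (a, s') ->
  {in live, forall i, 8 * thr i <= #|Fr :&: cls i|} ->
  exists l (X : {set V}), [/\ l <= 2 * #|K|, odd (h + l) = s (+) s',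
    X \subset cls a, 3 * thr a <= #|X| &
    {in X, forall x, tpath adjR ((N :\ z) :|: Fr) (h + l) z x}].
Proof.
case=> j [L [sL cL hL]] dNF con hFr.
have [x0 x0L] : exists x, x \in L by apply/card_gt0P; apply: leq_trans cL; rewrite muln_gt0.
have zj : connect dcover (chi z, s) (j, s (+) odd h).
  have := tpath_dcover s (hL x0 x0L).
  by have := subsetP sL x0 x0L; rewrite inE => /eqP->.
have jz : connect dcover (j, s (+) odd h) (a, s').
  by apply: connect_trans con; rewrite (sym_connect_sym dcover_sym).
have [l [X [l2 ol sX cX hX]]] := walk_to sL cL jz hFr.
exists l, X; split=> //; first by rewrite oddD ol; case: (s); case: (s'); case: (odd h).
move=> x /hX[y yL t]; apply: tpath_cat (hL y yL) t.
by apply: disjointWl dNF; apply: subsetDl.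
Qed.

Lemma alternating_stage (X A B T : {set V}) a b x : R a b ->
  X \subset cls a -> A \subset cls a -> B \subset cls b ->
  [disjoint A & B] -> [disjoint X & A] -> [disjoint X & B] ->
  3 * thr a <= #|X| -> x + 3 * thr a <= #|A| -> x + 2 * thr b <= #|B| ->
  (forall D : {set V}, D \subset cls a -> thr a <= #|D| ->
    exists u v, [/\ u \in D, v \in T & adjR u v]) ->
  exists x0 p w, [/\ x0 \in X, path adjR x0 p, uniq p & size p = x.*2] /\
    [/\ {subset p <= A :|: B},
        forall i, count (fun v => chi v == i) p <= x * ((a == i) + (b == i)),
        w \in T & adjR (last x0 p) w].
Proof.
move=> Rab sX sA sB dAB dXA dXB cX cA cB hT.
have XA : X :|: A \subset cls a by rewrite subUset sX.
have [||||||x0 [p [w [[x0X pp up sp] [sub cpA cpB wT lw]]]]] :=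
    @alternating_search V adjR A B dAB X T x (thr a) (thr b) dXA dXB.
- by apply: leq_trans cX; rewrite ltn_pmul2r.
- exact: cA.
- exact: cB.
- by move=> D S sD sS; apply: joined_thr Rab _ _ => //;
    [exact: subset_trans sD XA | exact: subset_trans sS sB].
- by move=> D S sD sS; apply: (@joined_thr _ _ _ _ _ _ E_gt0 R_joined b a) => //;
    [rewrite R_sym | exact: subset_trans sD sB | exact: subset_trans sS sA].
- by move=> D sD; apply: hT; exact: subset_trans sD XA.
exists x0, p, w; split; split=> // i.
rewrite mulnDr; apply: leq_trans (_ : count [in A] p * (a == i) + count [in B] p * (b == i) <= _); last by rewrite cpA cpB.
elim: p {pp up sp cpA cpB lw} sub => [|v p IH] sub //=.
have /IH le : {subset p <= A :|: B} by move=> u up; apply: sub; rewrite inE up orbT.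
have : v \in A :|: B by apply: sub; rewrite mem_head.
rewrite inE => /orP[vA|vB].
  have := subsetP sA v vA; rewrite inE => /eqP cv; rewrite cv vA.
  by clear - le; move: le; case: (v \in B); case: (a == i); case: (b == i); lia.
have := subsetP sB v vB; rewrite inE => /eqP cv; rewrite cv vB.
by clear - le; move: le; case: (v \in A); case: (a == i); case: (b == i); lia.
Qed.

End Routing.

(** * Assembling a cycle of prescribed length *)

Section Assembly.
Variables (V K : finType) (adj : rel V) (chi : V -> K) (R : rel K) (E : nat).
Hypotheses (E_gt0 : 0 < E)
  (R_joined : forall i j, R i j -> joined adj chi E i j).
Local Notation cls := (cls chi).
Local Notation thr := (class_threshold chi E).
Local Notation live := (live R).
Local Notation liveV := (liveV chi R).
Local Notation adjR := (class_adj adj chi R).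
Local Notation dcover := (double_cover R).
Hypotheses (R_sym : symmetric R) (adj_sym : symmetric adj).
Variables (q : K -> nat) (h : nat).
Local Notation leafy := (leafy adj chi R E h).
Hypothesis rich_region : forall N : {set V}, N \subset liveV ->
  {in live, forall i, #|N :&: cls i| = q i} ->
  exists Ns : {set V}, [/\ Ns \subset N,
    {in live, forall i, exists2 j, R i j & thr j <= #|Ns :&: cls j|} &
    {in Ns, forall z, leafy N z}].

(* A stage [(a, b, x)] is a stretch of [2 * x] steps alternating between the
   classes [a] and [b]; it visits each of them [x] times. *)
Definition usage (st : seq (K * K * nat)) i :=
  sumn [seq s.2 * ((s.1.1 == i) + (s.1.2 == i)) | s <- st].
(* A link between stages costs a tree path (h), a walk in the double cover (at
   most 2|K|) and one edge; closing the cycle costs two of each plus one edge. *)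
Definition overhead := h + 2 * #|K| + 1.
Definition min_gap := 2 * h + 4 * #|K| + 2.
Definition final_slack := 3 * h + 6 * #|K| + 4.

Lemma adjR_sym : symmetric adjR.
Proof. by move=> u v; rewrite /class_adj adj_sym R_sym. Qed.

Variables (t : nat) (zB : V) (NB LB : {set V}) (jB : K).
Hypotheses (zB_NB : zB \in NB) (LB_cls : LB \subset cls jB)
  (LB_card : 3 * thr jB <= #|LB|)
  (LB_reach : {in LB, forall v, tpath adjR (NB :\ zB) h zB v}).
Hypothesis odd_t : odd t -> connect dcover (chi zB, false) (chi zB, true).

(* The committed path [zB :: p] ends in [z], from which a tree can be grown in
   the fresh region [N]. *)
Record committed (st : seq (K * K * nat)) (p : seq V) (N : {set V}) (z : V) : Prop :=
  Committed {
  com_path : path adjR zB p;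
  com_last : last zB p = z;
  com_uniq : uniq (zB :: p);
  com_NB : forall v, v \in p -> v \notin NB;
  com_leafy : leafy N z;
  com_zN : z \in N;
  com_N : forall v, v \in N -> v != z -> v \notin zB :: p;
  com_NNB : [disjoint N & NB];
  com_Nq : {in live, forall i, #|N :&: cls i| = q i};
  com_st : forall s, s \in st -> R s.1.1 s.1.2 /\
    exists b, connect dcover (chi zB, false) (s.1.1, b);
  com_min : size p + min_gap <= t;
  com_max : t <= size p + 2 * sumn [seq s.2 | s <- st];
  com_room : {in live, forall i,
    count (fun v => chi v == i) (zB :: p) + usage st i + overhead * size st +
    final_slack + #|NB :&: cls i| + 2 * q i + 22 * thr i <= #|cls i|} }.

(** Stretches are performed in full as long as the remaining length permits another link and the
    closing. Otherwise the current stretch is adjusted so that closing the cycle gives length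
    exactly [t]; by [com_max] this happens before the stages run out. *)
Lemma main_loop st p N z : committed st p N z ->
  exists c, [/\ size c = t, cycle adjR c & uniq c].
Proof.
elim: st p N z => [|[[a b] x] st IH] p N z com.
  have := com_max com; have := com_min com; rewrite /min_gap /= muln0.
  by clear; lia.
have [pp lp up pNB lz zN pN dN cN hst tmin tmax room] := com.
have [/= Rab [sA conA]] := hst _ (mem_head _ _).
have Rba : R b a by rewrite R_sym.
have aL : a \in live := live_src Rab.
have bL : b \in live := live_src Rba.
pose Q := [set v in zB :: p] :|: NB :|: N.
(* The 22 thresholds are 8 for the walk leaving [z] through [FA], 8 for the closing walk through
   [FB], and 3 for each side of the stretch. Of the two quotas, one is the current [N], contained in
   [Q], and one remains for the next region. *)
pose room0 i := (overhead * size st + overhead + final_slack + q i + 22 * thr i +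
   x * ((a == i) + (b == i))).
have free : {in live, forall i, room0 i <= #|~: Q :&: cls i|}.
  move=> i il; have := room i il; rewrite /usage /=.
  have := cardsID Q (cls i).
  have -> : cls i :\: Q = ~: Q :&: cls i by rewrite setDE setIC.
  have : #|cls i :&: Q| <= #|cls i :&: [set v in zB :: p]| + #|NB :&: cls i| + #|N :&: cls i|.
    rewrite /Q !setIUr; apply: leq_trans (leq_card_setU _ _) _; rewrite (setIC N) leq_add2r.
    by apply: leq_trans (leq_card_setU _ _) _; rewrite (setIC NB).
  rewrite card_seq_setI // (cN i il) /room0.
  rewrite (eq_count (a2 := fun v => chi v == i)); last by move=> v; rewrite inE.
  rewrite -/(usage st i) mulnS /=.
  by move: (x * _) (_ * size st) (usage _ _) => ? ? ?; clear; lia.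
pose s8 i := 8 * thr i.
have [|FA [sFA _ cFA free1]] := @exists_quota_rest _ _ chi R (~: Q) s8 (fun i => overhead * size st + overhead + final_slack + q i + 14 * thr i + x * ((a == i) + (b == i))).
  by move=> i /free; apply: leq_trans; rewrite /room0 /s8; move: (x * _) (_ * size st) => ? ?; clear; lia.
have [|FB [sFB _ cFB free2]] := @exists_quota_rest _ _ chi R (~: Q :\: FA) s8 (fun i => overhead * size st + overhead + final_slack + q i + 6 * thr i + x * ((a == i) + (b == i))).
  by move=> i /free1; apply: leq_trans; rewrite /s8; move: (x * _) (_ * size st) => ? ?; clear; lia.
have Qout v : v \notin Q -> [/\ v \notin zB :: p, v \notin NB & v \notin N].
  move=> vQ; rewrite /Q !in_setU !negb_or in vQ.
  by case/andP: vQ => /andP[v1 v2] v3; split=> //; rewrite inE in v1.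
have notN (F : {set V}) : F \subset ~: Q -> [disjoint N & F].
  move=> sF; rewrite disjoint_sym disjoints_subset; apply: subset_trans sF _.
  by rewrite setCS subsetUr.
have con : connect dcover (chi zB, false) (chi z, odd (size p)).
  by have := path_dcover false pp; rewrite lp.
have conza : connect dcover (chi z, odd (size p)) (a, sA).
  by rewrite (sym_connect_sym (dcover_sym R_sym)) in con; apply: connect_trans con conA.
have [|l [X [l2 ol sX cX hX]]] := approach E_gt0 R_joined R_sym lz (notN _ sFA) conza.
  by move=> i /cFA ->.

have sXNF : {subset X <= N :|: FA}.
  move=> v vX; have := tpath_end (hX v vX).
  by rewrite !inE => /or3P[/eqP->|/andP[_ ->]|->]; rewrite ?zN ?orbT.
(* Tree, walk and stretch together, with the target left open: it is the next region's rich part in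
   one case and the far end of the tree grown at [zB] in the other. *)
have extend (G T : {set V}) x' : G \subset ~: Q :\: FA ->
    {in live, forall i, 6 * thr i + x' * ((a == i) + (b == i)) <= #|G :&: cls i|} ->
    (forall D : {set V}, D \subset cls a -> thr a <= #|D| ->
      exists u v, [/\ u \in D, v \in T & adjR u v]) ->
    exists p1 w, [/\ path adjR z p1, uniq p1, size p1 = h + l + x'.*2 &
      {subset p1 <= (N :\ z) :|: FA :|: G}] /\
      [/\ forall i, count (fun v => chi v == i) p1 <= h + l + x' * ((a == i) + (b == i)),
          w \in T & adjR (last z p1) w].
  move=> sG roomG hT.
  pose qA i := if i == a then x' + 3 * thr a else 0.
  pose qB i := if i == b then x' + 3 * thr b else 0.
  have [|SA [sSA _ cSA restA]] := @exists_quota_rest _ _ chi R G qA qB.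
    move=> i /roomG; apply: leq_trans; rewrite /qA /qB ![_ == i]eq_sym.
    by case: eqP => [->|_]; case: eqP => [->|_]; rewrite /=; clear; lia.
  pose A := SA :&: cls a; pose B := (G :\: SA) :&: cls b.
  have cA : x' + 3 * thr a <= #|A| by rewrite /A cSA // /qA eqxx.
  have cB : x' + 2 * thr b <= #|B|.
    by apply: leq_trans (restA b bL); rewrite /qB eqxx leq_add2l leq_mul2r orbT.
  have sAG : A \subset G by apply: subset_trans sSA; apply: subsetIl.
  have sBG : B \subset G by apply: subset_trans (subsetIl _ _) (subsetDl _ _).
  have dNG v : v \in N :|: FA -> v \notin G.
    by move=> vNF; apply/negP => /(subsetP sG); move: vNF; rewrite !inE;
      case: (v \in FA); case: (v \in N); rewrite ?orbT ?andbF.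
  have dX (F : {set V}) : F \subset G -> [disjoint X & F].
    move=> sF; rewrite disjoints_subset; apply/subsetP => v /sXNF /dNG vG.
    by rewrite inE; apply: contra vG; apply: (subsetP sF).
  have dAB : [disjoint A & B].
    rewrite disjoints_subset; apply/subsetP => v; rewrite !inE.
    by case: (v \in SA).
  have [x0 [p2 [w [[x0X pp2 up2 sp2] [sub2 c2 wT lw]]]]] :=
    alternating_stage E_gt0 R_joined R_sym Rab sX (subsetIr _ _) (subsetIr _ _)
      dAB (dX _ sAG) (dX _ sBG) cX cA cB hT.
  have [p0 [sp0 pp0 lp0 up0 sub0]] := hX x0 x0X.
  exists (p0 ++ p2), w; split; split.
  - by rewrite cat_path pp0 lp0.
  - rewrite cat_uniq up0 up2 andbT; apply/hasPn => v /sub2 vAB; apply/negP => /sub0 v0.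
    have /dNG/negP[] : v \in N :|: FA by move: v0; rewrite !inE => /orP[/andP[_ ->]|->]; rewrite ?orbT.
    by move: vAB; rewrite inE => /orP[/(subsetP sAG)|/(subsetP sBG)].
  - by rewrite size_cat sp0 sp2.
  - move=> v; rewrite mem_cat => /orP[/sub0|/sub2]; rewrite [v \in _ :|: G]inE.
      by move=> ->.
    by rewrite inE => /orP[/(subsetP sAG)|/(subsetP sBG)] ->; rewrite orbT.
  - by move=> i; rewrite count_cat leq_add // -sp0 count_size.
  - by [].
  - by rewrite last_cat lp0.
case: (leqP (size p + 2 * x + h + 2 * #|K| + 1 + min_gap) t) => [far|near].
  have [|N' [sN' N'l cN' free3]] := @exists_quota_rest _ _ chi R (~: Q :\: FA) q (fun i => 6 * thr i + x * ((a == i) + (b == i))).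
    by move=> i /free1; apply: leq_trans; move: (x * _) (_ * size st) => ? ?; clear; lia.
  have [Ns [sNs hNs leafNs]] := rich_region N'l cN'.
  have [j Raj cj] := hNs a aL.
  have [||D sD cD|p1 [w [[pp1 up1 sp1 sub1] [c1 wT lw]]]] := extend (~: Q :\: FA :\: N') (Ns :&: cls j) x.
  - exact: subsetDl.
  - exact: free3.
  - exact: joined_thr Raj sD (subsetIr _ _) cD cj.
  have wNs : w \in Ns by move: wT; rewrite inE => /andP[].
  have wN' : w \in N' := subsetP sNs w wNs.
  have notQ v : v \in N' -> v \notin Q /\ v \notin FA.
    by move=> /(subsetP sN'); rewrite inE inE => /andP[].
  have wp1 v : v \in N' -> v \notin p1.
    move=> vN'; apply/negP => /sub1; have [vQ vFA] := notQ v vN'.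
    rewrite inE [v \in _ :\: N']inE vN' orbF inE (negPf vFA) orbF inE => /andP[_ vN].
    by case/negP: vQ; rewrite inE vN orbT.
  have p1Q v : v \in p1 -> v \notin zB :: p /\ v \notin NB.
    move=> /sub1; rewrite -setUA inE => /orP[|vF].
      rewrite 2!inE => /andP[vz vN]; split; first exact: pN.
      by rewrite (disjointFr dN vN).
    suff /Qout[] : v \notin Q by [].
    move: vF; rewrite in_setU => /orP[/(subsetP sFA)|]; first by rewrite in_setC.
    by rewrite !in_setD in_setC => /and3P[].
  (* Only [N'] stays reserved: what the tree in [N] did not use becomes free again, being neither on
     the path nor in the new region. *)
  apply: (IH (p ++ rcons p1 w) N' w); split.
  - by rewrite cat_path pp lp rcons_path pp1.
  - by rewrite last_cat last_rcons.
  - rewrite -cat_cons cat_uniq up /= rcons_uniq wp1 // up1 !andbT.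
    apply/hasPn => v; rewrite mem_rcons inE => /orP[/eqP->|/p1Q[] //].
    by have [/Qout[]] := notQ w wN'.
  - move=> v; rewrite mem_cat mem_rcons inE => /or3P[/pNB //|/eqP->|/p1Q[] //].
    by have [/Qout[]] := notQ w wN'.
  - exact: leafNs.
  - exact: wN'.
  - move=> v vN' vw; have [/Qout[vp _ _] _] := notQ v vN'.
    by rewrite -cat_cons mem_cat (negPf vp) mem_rcons in_cons (negPf vw) (negPf (wp1 v vN')).
  - rewrite disjoints_subset; apply/subsetP => v /notQ[/Qout[_ vNB _] _].
    by rewrite in_setC.
  - exact: cN'.
  - by move=> s sst; apply: hst; rewrite inE sst orbT.
  - by rewrite size_cat size_rcons sp1; clear -far l2; lia.
  - by move: tmax; rewrite size_cat size_rcons sp1 /=; clear; lia.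
  - move=> i il; have := room i il; rewrite -cat_cons count_cat -cats1 count_cat /usage /=.
    have := c1 i; rewrite -/(usage st i) mulnS addn0.
    have : (chi w == i) <= 1 by case: (_ == _).
    rewrite /overhead; move: (x * _) (_ * size st) (usage _ _) => ? ? ?.
    by clear - l2; lia.

have [v0 v0L] : exists v, v \in LB by apply/card_gt0P; apply: leq_trans LB_card; rewrite muln_gt0.
have conB : connect dcover (chi zB, false) (jB, odd h).
  by have := tpath_dcover false (LB_reach v0L); have := subsetP LB_cls v0 v0L; rewrite inE => /eqP->.
have conb : connect dcover (chi zB, false) (b, ~~ sA).
  by apply: connect_trans conA (connect1 _); rewrite /double_cover /= Rab; case: (sA).
(* The stretch ends in [a] and its last edge goes to [b], so arriving at [b] in layer [~~ sA] from
   the side of [zB] would close an even cycle. For odd [t] the other layer is needed, and [odd_t]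
   makes it reachable. *)
pose sB := odd t (+) ~~ sA.
have conBb : connect dcover (jB, odd h) (b, sB).
  rewrite (sym_connect_sym (dcover_sym R_sym)) in conB; apply: connect_trans conB _.
  rewrite /sB; case: (boolP (odd t)) => [/odd_t flip|_]; last by rewrite addFb.
  by apply: connect_trans flip _; rewrite addTb; apply: (connect_dcover_flip conb).
have [|r [YB [r2 oddr sYB cYB hYB]]] := walk_to E_gt0 R_joined R_sym LB_cls LB_card conBb (_ : {in live, forall i, 8 * thr i <= #|FB :&: cls i|}).
  by move=> i /cFB ->.
pose x' := (t - (size p + h + l + 1 + h + r))./2.
have tE : t = size p + (h + l + x'.*2) + (h + r) + 1.
  have : odd (t - (size p + h + l + 1 + h + r)) = false.
    rewrite oddB; last by move: tmin; rewrite /min_gap; clear -l2 r2; lia.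
    rewrite !oddD oddr /sB; move: ol; rewrite !oddD.
    by case: (odd t); case: (odd (size p)); case: (odd h); case: (odd l); case: (sA).
  by move: tmin; rewrite /x' /min_gap; clear -l2 r2; lia.
(* The full stretch did not fit, so the remaining length is below [2 * x + overhead + min_gap], and
   [final_slack] is [overhead + min_gap + 1]. *)
have x'_le : x' * 2 <= 2 * x + final_slack.
  by move: near tE; rewrite /final_slack /min_gap; clear - l2 r2; lia.
have [||D sD cD|p1 [w [[pp1 up1 sp1 sub1] [c1 wT lw]]]] := extend (~: Q :\: FA :\: FB) YB x'.
- exact: subsetDl.
- move=> i /free2; apply: leq_trans; move: x'_le.
  by case: (a == i); case: (b == i); move: (_ * size st) => ?; clear; lia.
- by apply: joined_thr Rab sD sYB cD _ => //; apply: leq_trans cYB; rewrite leq_pmull.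
have [x0 x0L tw] := hYB w wT.
have FBQ v : v \in FB -> v \notin Q /\ v \notin FA.
  by move=> /(subsetP sFB); rewrite in_setD in_setC => /andP[].
have dNBF : [disjoint NB :\ zB & FB].
  apply: (disjointWl (subsetDl _ _)); rewrite disjoint_sym disjoints_subset.
  by apply/subsetP => v /FBQ[/Qout[_ vNB _] _]; rewrite in_setC.
have t2 := tpath_cat dNBF (LB_reach x0L) tw.
have p1Q v : v \in p1 -> [/\ v \notin zB :: p, v \notin NB & v \notin FB].
  move=> /sub1; rewrite -setUA in_setU => /orP[|vF].
    rewrite 2!inE => /andP[vz vN]; have vp := pN v vN vz.
    have vNB : v \notin NB by rewrite (disjointFr dN vN).
    have vFB : v \notin FB.
      by apply/negP => /FBQ[/Qout[_ _]]; rewrite vN.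
    by split.
  have [vQ vFB] : v \notin Q /\ v \notin FB.
    move: vF; rewrite in_setU => /orP[vFA|]; last by rewrite !in_setD in_setC => /and3P[].
    split; first by move: (subsetP sFA v vFA); rewrite in_setC.
    by apply/negP => /FBQ[_]; rewrite vFA.
  by have [v1 v2 _] := Qout v vQ; split.
have dT : [disjoint [set v in p ++ p1] & (NB :\ zB) :|: FB].
  rewrite disjoints_subset; apply/subsetP => v; rewrite inE mem_cat in_setC in_setU in_setD negb_or.
  case/orP=> [vp|/p1Q[_ vNB vFB]]; last by rewrite (negPf vNB) andbF.
  rewrite (negPf (pNB v vp)) andbF /=; apply/negP => /FBQ[/Qout[]].
  by rewrite in_cons vp orbT.
have t1 : tpath adjR [set v in p ++ p1] (size p + (h + l + x'.*2)) zB (last z p1).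
  exists (p ++ p1); split.
  - by rewrite size_cat sp1.
  - by rewrite cat_path pp lp.
  - by rewrite last_cat lp.
  - rewrite cat_uniq up1 andbT; move: up => /= /andP[_ ->] /=.
    by apply/hasPn => v /p1Q[]; rewrite in_cons negb_or => /andP[].
  - by move=> v vp; rewrite inE.
have [c [sc cc uc]] : exists c, [/\ size c = (size p + (h + l + x'.*2) + (h + r)).+1, cycle adjR c & uniq c].
  apply: (tpath_cycle adjR_sym _ _ dT t1 t2 lw).
  - rewrite inE mem_cat negb_or; apply/andP; split; first by move: up => /= /andP[].
    by apply/negP => /p1Q[]; rewrite mem_head.
  - rewrite !inE eqxx /=; apply/negP => /FBQ[/Qout[]]; by rewrite mem_head.
by exists c; split=> //; rewrite sc [RHS]tE addn1.
Qed.

End Assembly.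

(** * From closed walks in the reduced graph to cycles *)

Section ClosedWalk.
Variables (V K : finType) (adj : rel V) (chi : V -> K) (R : rel K) (E : nat).
Local Notation cls := (cls chi).
Local Notation thr := (class_threshold chi E).
Local Notation live := (live R).
Local Notation adjR := (class_adj adj chi R).
Local Notation dcover := (double_cover R).
Hypotheses (R_joined : forall i j, R i j -> joined adj chi E i j)
  (R_sym : symmetric R) (adj_sym : symmetric adj).
Variables (t' : nat) (c : 'I_t'.+1 -> K).
Local Notation t := t'.+1.
Hypothesis walk_c : forall s, R (c s) (c (ordS s)).

Definition visits i := #|[set s | c s == i]|.
Definition traversals (ij : K * K) := #|[set s | (c s == ij.1) && (c (ordS s) == ij.2)]|.
(** All steps of the walk from [i] to [j] are gathered into a single stretch. With [m] such steps
    its length is [m] rounded up to an even number, so that it can end in the class where it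
    began. *)
Definition stages :=
  [seq (ij, uphalf (traversals ij)) | ij <- enum {: K * K} & 0 < traversals ij].

Lemma walk_dcover (s : 'I_t) : connect dcover (c ord0, false) (c s, odd s).
Proof.
case: s => m lt_m /=; elim: m lt_m => [|m IH] lt_m.
  by rewrite (_ : Ordinal lt_m = ord0) ?connect0 //; apply: val_inj.
have lt_m' : m < t by apply: ltnW.
apply: connect_trans (IH lt_m') (connect1 _); rewrite /double_cover /=.
have -> : Ordinal lt_m = ordS (Ordinal lt_m') by apply: val_inj; rewrite /= modn_small.
by rewrite walk_c; case: (odd m).
Qed.

(** An odd closed walk connects the two layers; this is how an odd [t] certifies that the component
    of the walk is not bipartite. *)
Lemma walk_dcover_closed : connect dcover (c ord0, false) (c ord0, odd t).
Proof.
apply: connect_trans (walk_dcover ord_max) (connect1 _); rewrite /double_cover /=.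
have -> : ord0 = ordS (@ord_max t') by apply: val_inj; rewrite /= modnn.
by rewrite walk_c; case: (odd t').
Qed.

Lemma sum_traversals_src i : \sum_j traversals (i, j) = visits i.
Proof.
rewrite /visits -sum1_card (partition_big (fun s => c (ordS s)) xpredT) //=.
by apply: eq_bigr => j _; rewrite sum1_card; apply: eq_card => s; rewrite [RHS]unfold_in !inE.
Qed.

Lemma sum_traversals_tgt i : \sum_j traversals (j, i) = visits i.
Proof.
have -> : visits i = #|[set s | c (ordS s) == i]|.
  rewrite /visits -(card_preimset _ (@ordS_inj t)).
  by apply: eq_card => s; rewrite !inE.
rewrite -sum1_card (partition_big c xpredT) //=.
by apply: eq_bigr => j _; rewrite sum1_card; apply: eq_card => s; rewrite [RHS]unfold_in !inE andbC.
Qed.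

Lemma sum_traversals : \sum_ij traversals ij = t.
Proof.
rewrite -[RHS]card_ord -sum1_card.
rewrite (partition_big (fun s => (c s, c (ordS s))) xpredT) //=.
apply: eq_bigr => -[i j] _; rewrite sum1_card.
by apply: eq_card => s; rewrite [RHS]unfold_in !inE.
Qed.

Lemma stages_length : t <= 2 * sumn [seq s.2 | s <- stages].
Proof.
rewrite -sum_traversals sumnE !big_map big_filter big_enum_cond /= big_distrr /=.
rewrite [leqRHS]big_mkcond /=; apply: leq_sum => ij _.
by case: ltnP => [_|]; [clear; lia | rewrite leqn0 => /eqP->].
Qed.

Lemma size_stages : size stages <= #|K| * #|K|.
Proof.
rewrite size_map size_filter (leq_trans (count_size _ _)) // -cardE.
by rewrite -card_prod.
Qed.

(** Doubled, the usage of [i] is the number of steps leaving [i] plus the number entering [i], each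
    equal to [visits i], up to a rounding error of one for each ordered pair at [i], counted with
    multiplicity. *)
Lemma stages_usage i : usage stages i <= visits i + #|K|.
Proof.
rewrite /usage sumnE !big_map big_filter big_enum_cond /=.
suff : 2 * \sum_(ij : K * K) uphalf (traversals ij) * ((ij.1 == i) + (ij.2 == i)) <=
    2 * (visits i + #|K|).
  rewrite leq_mul2l /=; apply: leq_trans; rewrite [leqRHS](bigID (fun ij => 0 < traversals ij)) /=.
  exact: leq_addr.
rewrite big_distrr /=.
apply: leq_trans (_ : \sum_(ij : K * K) (traversals ij).+1 * ((ij.1 == i) + (ij.2 == i)) <= _).
  by apply: leq_sum => ij _; rewrite mulnA leq_mul2r; apply/orP; right; clear; lia.
under eq_bigr do rewrite mulnDr.
rewrite big_split /=.
have delta (f : K -> nat) : \sum_a f a * (a == i) = f i.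
  rewrite (bigD1 i) //= eqxx muln1 [X in _ + X]big1 ?addn0 // => a ai.
  by rewrite (negPf ai) muln0.
have -> : \sum_(ij : K * K) (traversals ij).+1 * (ij.1 == i) = visits i + #|K|.
  rewrite -(pair_bigA _ (fun a b => (traversals (a, b)).+1 * (a == i))) /=.
  under eq_bigr do rewrite -big_distrl /=.
  rewrite delta; under eq_bigr do rewrite -addn1.
  by rewrite big_split /= sum_traversals_src sum1_card.
have -> : \sum_(ij : K * K) (traversals ij).+1 * (ij.2 == i) = visits i + #|K|.
  rewrite -(pair_bigA _ (fun a b => (traversals (a, b)).+1 * (b == i))) /= exchange_big /=.
  under eq_bigr do rewrite -big_distrl /=.
  rewrite delta; under eq_bigr do rewrite -addn1.
  by rewrite big_split /= sum_traversals_tgt sum1_card.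
by rewrite mul2n addnn.
Qed.

Variables (y z d h : nat).
Hypotheses (z_gt0 : 0 < z) (y_gt0 : 0 < y) (V_gt0 : 0 < #|V|) (d_ge2 : 2 <= d)
  (E_large : 2000 * z * y * (d + 3) < E).
Hypothesis R_degree : {in live, forall i, #|V| <= y * \sum_(j | R i j) #|cls j|}.
Hypothesis room_c : {in live, forall i, z * visits i + #|cls i| <= z * #|cls i|}.
Hypothesis cls_large : {in live, forall i, E <= #|cls i| /\
  4 * z * (#|K| + 2 + overhead K h * (#|K| * #|K|) + final_slack K h) <= #|cls i|}.
Hypotheses (h_small : forall r, r < h -> E * d ^ r <= 6 * #|V|)
  (h_large : 6 * #|V| <= E * d ^ h) (t_large : min_gap K h < t).

Theorem cycle_of_closed_walk : exists cyc, [/\ size cyc = t, cycle adj cyc & uniq cyc].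
Proof.
(* The walk leaves [1 / z] of each class unvisited. The regions take at most [3 / (8 * z)] of the
   class, the 22 thresholds at most [22 / (128 * z)], and links, slack and rounding at most
   [1 / (4 * z)]. *)
pose w := 64 * z; pose q i := #|cls i| %/ (8 * z).
have E_gt0 : 0 < E by apply: leq_ltn_trans E_large.
have E_large' : 24 * w * y * (d + 3) < E.
  apply: leq_ltn_trans E_large; rewrite /w.
  have -> : 24 * (64 * z) * y * (d + 3) = 1536 * (z * y * (d + 3)) by clear; lia.
  have -> : 2000 * z * y * (d + 3) = 2000 * (z * y * (d + 3)) by clear; lia.
  by rewrite leq_mul2r orbT.
have E256 : 256 * z <= E.
  apply: leq_trans (ltnW E_large); rewrite -[256 * z]muln1 -!mulnA leq_mul //.
  rewrite leq_mul2l; apply/orP; right; rewrite muln_gt0 y_gt0 addn_gt0 orbT; by [].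
have thr_le i : i \in live -> 2 * w * thr i <= #|cls i|.
  case/cls_large => Ei _; rewrite /w /class_threshold.
  have := leq_divM #|cls i| E; set a := #|_| %/ _ => le1.
  have le2 : a * (256 * z) <= a * E by rewrite leq_mul2l E256 orbT.
  have -> : 2 * (64 * z) * a.+1 = 128 * (z * a) + 128 * z by clear; lia.
  by clear -le1 le2 Ei E256; lia.
have q_ge i : i \in live -> #|cls i| <= w * q i.
  case/cls_large => Ei _; rewrite /w /q; have := ltn_ceil #|cls i| (d := 8 * z).
  rewrite muln_gt0 z_gt0 /= => /(_ isT); set a := _ %/ _ => lt1.
  have : 0 < a by rewrite divn_gt0 ?muln_gt0 ?z_gt0 //; clear - Ei E256; lia.
  have : a.+1 * (8 * z) = 8 * (z * a) + 8 * z by clear; lia.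
  have -> : 64 * z * a = 64 * (z * a) by clear; lia.
  move=> e a0; have : z <= z * a by rewrite leq_pmulr.
  by rewrite e in lt1; clear -lt1; lia.
have q_le i : 8 * (z * q i) <= #|cls i|.
  by have := leq_divM #|cls i| (8 * z); rewrite -/(q i); clear; lia.
have rich (N : {set V}) : N \subset liveV chi R ->
    {in live, forall i, #|N :&: cls i| = q i} ->
    exists Ns : {set V}, [/\ Ns \subset N,
      {in live, forall i, exists2 j, R i j & thr j <= #|Ns :&: cls j|} &
      {in Ns, forall z, leafy adj chi R E h N z}].
  move=> Nl Nq; apply: (exists_rich E_gt0 R_joined V_gt0 d_ge2 E_large' R_degree _ R_sym Nl _ h_small h_large).
    by move=> i il; split; [have [] := cls_large il | exact: thr_le].
  by move=> i il; rewrite Nq // q_ge.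
have cl s : c s \in live by apply: live_src (walk_c s).
have [|NB [_ NBl NBq free]] := @exists_quota_rest _ _ chi R [set: V] q q.
  move=> i il; rewrite setTI; apply: leq_trans (q_le i); rewrite -/(q i).
  by rewrite mulnA; apply: leq_trans (_ : (8 * z) * q i <= _) => //; rewrite addnn -mul2n leq_mul2r;
    apply/orP; right; clear -z_gt0; lia.
have [N [sN Nl Nq]] := @exists_quota _ _ chi R _ _ free.
have [NsB [sNsB hNsB leafB]] := rich NB NBl NBq.
have [Ns [sNs hNs leafN]] := rich N Nl Nq.
(* The rich parts of the two regions are made to meet in an edge: [j1] is found next to the walk and
   [j2] next to [j1]. Thus both ends of the initial path [zB], [zA] are roots of trees. *)
have [j1 Rj1 cj1] := hNsB _ (cl ord0).
have [j2 Rj2 cj2] := hNs j1 (live_src (etrans (R_sym _ _) Rj1)).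
have [zB [zA [zB1 zA1 edge]]] := joined_thr E_gt0 R_joined Rj2 (subsetIr _ _) (subsetIr _ _) cj1 cj2.
move: zB1 zA1; rewrite 2!in_setI => /andP[zBs zBj] /andP[zAs _].
have chiB : chi zB = j1 by move: zBj; rewrite inE => /eqP.
have zBN := subsetP sNsB zB zBs; have zAN := subsetP sNs zA zAs.
have dNNB : [disjoint N & NB].
  by rewrite disjoints_subset (subset_trans sN) // setTD.
have [jB [LB [sLB cLB hLB]]] := leafB zB zBs.
have start : connect dcover (chi zB, false) (c ord0, true).
  by apply: connect1; rewrite /double_cover /= chiB R_sym Rj1.
have start' : connect dcover (chi zB, true) (c ord0, false) := connect_dcover_flip start.
have csym := sym_connect_sym (dcover_sym R_sym).
have odd_t : odd t -> connect dcover (chi zB, false) (chi zB, true).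
  move=> ot; have := walk_dcover_closed; rewrite ot csym => back.
  by apply: connect_trans start (connect_trans back _); rewrite csym.
have [|cyc [sc cc uc]] := @main_loop _ _ _ _ _ _ E_gt0 R_joined R_sym adj_sym q h rich t zB NB LB jB sLB cLB hLB odd_t stages [:: zA] N zA.
  split=> //=.
  - by rewrite edge.
  - rewrite inE andbT; apply/eqP => eq_z; move: zAN; rewrite -eq_z.
    by move/(disjointFr dNNB); rewrite zBN.
  - by move=> v; rewrite inE => /eqP->; rewrite (disjointFr dNNB zAN).
  - exact: leafN.
  - move=> v vN vz; rewrite !inE (negPf vz) orbF; apply: contraTneq vN => ->.
    by rewrite (disjointFl dNNB zBN).
  - move=> s /mapP[[i j]]; rewrite mem_filter => /andP[W _] -> /=.
    have /set0Pn[s0] : [set s | (c s == i) && (c (ordS s) == j)] != set0 by rewrite -card_gt0.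
    rewrite inE => /andP[/eqP <- /eqP <-]; split; first exact: walk_c.
    exists (~~ odd s0); apply: connect_trans start _.
    exact: (connect_dcover_flip (walk_dcover s0)).
  - by apply: leq_trans stages_length _; rewrite leq_addl.
  - move=> i il; rewrite (NBq i il).
    have [_ big] := cls_large il; have := room_c il; have := q_le i; have := thr_le i il.
    have := stages_usage i.
    have : overhead K h * size stages <= overhead K h * (#|K| * #|K|).
      by rewrite leq_mul2l size_stages orbT.
    have : (chi zB == i) + ((chi zA == i) + 0) <= 2 by case: (_ == _); case: (_ == _).
    move: (#|K|) (#|cls i|) (_ + (_ + 0)) (overhead K h * size stages) (overhead K h * (#|K| * #|K|)) (final_slack _ _) (usage _ _) (thr i) (q i) (visits i) big => n9 n10 n1 n2 n3 n4 n5 n6 n7 n8 big l1 l2 l3 l4 l5 l6.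
    rewrite -(leq_pmul2l z_gt0) !mulnDr.
    have : z * n1 <= z * 2 by rewrite leq_mul2l l1 orbT.
    have : z * n2 <= z * n3 by rewrite leq_mul2l l2 orbT.
    have : z * n5 <= z * (n8 + n9) by rewrite leq_mul2l l3 orbT.
    move: l4 l5 l6 big; rewrite /w !mulnDr; clear; lia.
by exists cyc; split=> //; apply: sub_cycle cc => u v /andP[].
Qed.

End ClosedWalk.

(** * A regularity lemma for holes *)

Section Refinement.
Variables (V : finType) (adj : rel V) (E : nat).

Section OneStep.
Variables (K : finType) (chi : V -> K).
Local Notation cls := (cls chi).

Definition joinedb i j := [forall A : {set V}, forall B : {set V},
  [&& A \subset cls i, B \subset cls j, #|cls i| <= E * #|A| & #|cls j| <= E * #|B|] ==>
  [exists u in A, exists v in B, adj u v]].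

Lemma joinedP i j : reflect (joined adj chi E i j) (joinedb i j).
Proof.
apply: (iffP forallP) => [H A B sA sB cA cB|H A].
  have /forallP/(_ B) := H A; rewrite sA sB cA cB /=.
  by case/existsP => u /andP[uA /existsP[v /andP[vB uv]]]; exists u, v.
apply/forallP => B; apply/implyP => /and4P[sA sB cA cB].
have [u [v [uA vB uv]]] := H A B sA sB cA cB.
by apply/existsP; exists u; rewrite uA; apply/existsP; exists v; rewrite vB.
Qed.

Definition edgeless i j := [forall u in cls i, forall v in cls j, ~~ adj u v].

Definition bad ij := ~~ edgeless ij.1 ij.2 && ~~ joinedb ij.1 ij.2.

Definition cls_pairs (P : pred (K * K)) : {set V * V} :=
  [set uv | P (chi uv.1, chi uv.2)].

Lemma card_pairs_in (P : pred (K * K)) (A B : K * K -> {set V}) :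
  (forall ij, A ij \subset cls ij.1) -> (forall ij, B ij \subset cls ij.2) ->
  #|[set uv | [&& P (chi uv.1, chi uv.2), uv.1 \in A (chi uv.1, chi uv.2) &
     uv.2 \in B (chi uv.1, chi uv.2)]]| = \sum_(ij | P ij) #|A ij| * #|B ij|.
Proof.
move=> sA sB; rewrite -sum1_card (partition_big (fun uv => (chi uv.1, chi uv.2)) P).
  apply: eq_bigr => ij Pij; rewrite sum1_card -cardsX.
  apply: eq_card => -[u v]; rewrite [LHS]unfold_in !inE /=.
  apply/andP/andP => [[/and3P[_ uA vB] /eqP <-] //|[uA vB]].
  have := subsetP (sA ij) u uA; have := subsetP (sB ij) v vB.
  rewrite !inE => /eqP ev /eqP eu; rewrite eu ev -surjective_pairing.
  by rewrite Pij uA vB eqxx.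
by move=> uv; rewrite inE => /and3P[].
Qed.

Lemma card_cls_pairs P : #|cls_pairs P| = \sum_(ij | P ij) #|cls ij.1| * #|cls ij.2|.
Proof.
rewrite -(@card_pairs_in P (fun ij => cls ij.1) (fun ij => cls ij.2)) //.
by apply: eq_card => uv; rewrite !inE !eqxx !andbT.
Qed.

End OneStep.

Definition edgeless_pairs (K : finType) (chi : V -> K) :=
  cls_pairs chi (fun ij => edgeless chi ij.1 ij.2).

(** Each pair that is not joined has a hole, a rectangle [A * B] without edges that fills
    [1 / E ^ 2] of the pair. The new classes record membership in all holes, two bits for each old
    class. Holes of bad pairs are new energy because a bad pair is not edgeless. *)
Lemma refine (K : finType) (chi : V -> K) : exists (K' : finType) (chi' : V -> K'),
  #|K'| = #|K| * 4 ^ #|K| /\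
  E * E * #|edgeless_pairs chi| + #|cls_pairs chi (bad chi)| <=
  E * E * #|edgeless_pairs chi'|.
Proof.
have /fin_all_exists[H hH] : forall ij : K * K, exists AB : {set V} * {set V},
    [/\ AB.1 \subset cls chi ij.1, AB.2 \subset cls chi ij.2 &
     ~~ joinedb chi ij.1 ij.2 ->
     [/\ #|cls chi ij.1| <= E * #|AB.1|, #|cls chi ij.2| <= E * #|AB.2| &
         forall u v, u \in AB.1 -> v \in AB.2 -> ~~ adj u v]].
  move=> [i j] /=; case: (boolP (joinedb chi i j)) => [_|].
    by exists (set0, set0); rewrite !sub0set.
  rewrite negb_forall => /existsP[A]; rewrite negb_forall => /existsP[B]; rewrite negb_imply => /andP[/and4P[sA sB cA cB] no].
  exists (A, B); split=> // _; split=> // u v uA vB; apply: contra no => uv.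
  by apply/existsP; exists u; rewrite uA; apply/existsP; exists v; rewrite vB.
pose A ij := (H ij).1; pose B ij := (H ij).2.
have sA ij : A ij \subset cls chi ij.1 by have [] := hH ij.
have sB ij : B ij \subset cls chi ij.2 by have [] := hH ij.
pose chi' v : K * {ffun K -> bool * bool} :=
  (chi v, [ffun j => (v \in A (chi v, j), v \in B (j, chi v))]).
exists (K * {ffun K -> bool * bool})%type, chi'; split.
  by rewrite card_prod card_ffun card_prod card_bool.
pose new := [set uv | [&& bad chi (chi uv.1, chi uv.2), uv.1 \in A (chi uv.1, chi uv.2) &
     uv.2 \in B (chi uv.1, chi uv.2)]].
have le_new : #|cls_pairs chi (bad chi)| <= E * E * #|new|.
  rewrite /new (card_pairs_in (bad chi) sA sB) card_cls_pairs big_distrr /=.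
  apply: leq_sum => ij /andP[_ nj]; have [_ _ /(_ nj)[c1 c2 _]] := hH ij.
  by rewrite mulnACA leq_mul.
have dis : [disjoint edgeless_pairs chi & new].
  rewrite disjoints_subset; apply/subsetP => uv; rewrite !inE => el.
  by rewrite /bad /= el.
have sub : edgeless_pairs chi :|: new \subset edgeless_pairs chi'.
  apply/subsetP => -[u v]; rewrite !inE /= => /orP[/forallP el|].
    apply/forallP => a; apply/implyP; rewrite inE => /eqP[ea _].
    apply/forallP => b; apply/implyP; rewrite inE => /eqP[eb _].
    by move: (el a); rewrite inE ea eqxx /= => /forallP/(_ b); rewrite inE eb eqxx.
  case/and3P => /andP[_ nj] uA vB; have [_ _ /(_ nj)[_ _ noedge]] := hH (chi u, chi v).
  apply/forallP => a; apply/implyP; rewrite inE => /eqP[ea /ffunP/(_ (chi v))].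
  rewrite !ffunE ea => -[aA _].
  apply/forallP => b; apply/implyP; rewrite inE => /eqP[eb /ffunP/(_ (chi u))].
  rewrite !ffunE eb => -[_ bB].
  by apply: noedge; rewrite -/(A _) -/(B _) ?aA ?bB.
apply: leq_trans (_ : E * E * #|edgeless_pairs chi :|: new| <= _).
  by rewrite cardsU (disjoint_setI0 dis) cards0 subn0 mulnDr leq_add2l.
by rewrite leq_mul2l subset_leq_card ?orbT.
Qed.

End Refinement.

Definition part_bound b E := iter (b * (E * E)).+1 (fun m => m * 4 ^ m) 1.

Lemma part_bound_gt0 b E : 0 < part_bound b E.
Proof.
by rewrite /part_bound; elim: (b * (E * E)).+1 => [//|k IH] /=; rewrite muln_gt0 IH expn_gt0.
Qed.

(* The energy is the number of vertex pairs lying in edgeless pairs of classes: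
   cutting along the holes of a non-joined pair makes a 1/E^2 fraction of it
   edgeless, so few refinements suffice. *)
Theorem regular_partition (V : finType) (adj : rel V) (b E : nat) : 0 < #|V| ->
  exists (K : finType) (chi : V -> K), #|K| <= part_bound b E /\
    b * #|cls_pairs chi (bad adj E chi)| <= #|V| * #|V|.
Proof.
move=> V0; pose M s := iter s (fun m => m * 4 ^ m) 1.
have M_mono s : M s <= M s.+1 by rewrite /M iterS leq_pmulr // expn_gt0.
suff main s : s <= (b * (E * E)).+1 ->
  (exists (K : finType) (chi : V -> K), #|K| <= part_bound b E /\
    b * #|cls_pairs chi (bad adj E chi)| <= #|V| * #|V|) \/
  exists (K : finType) (chi : V -> K), #|K| <= M s /\
    s * (#|V| * #|V|) <= b * (E * E) * #|edgeless_pairs adj chi|.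
  have [//|[K [chi [_]]]] := main _ (leqnn _).
  have : #|edgeless_pairs adj chi| <= #|V| * #|V| by rewrite -card_prod max_card.
  move: (#|edgeless_pairs _ _|) (b * (E * E)) => x y le1.
  have : y * x <= y * (#|V| * #|V|) by rewrite leq_mul2l le1 orbT.
  have : 0 < #|V| * #|V| by rewrite muln_gt0 V0.
  by rewrite mulSn; clear; lia.
elim: s => [|s IH] les.
  by right; exists unit, (fun=> tt); rewrite card_unit.
have [|//|[K [chi [cK en]]]] := IH; [exact: ltnW | by left|].
case: (leqP (b * #|cls_pairs chi (bad adj E chi)|) (#|V| * #|V|)) => [good|many].
  left; exists K, chi; split=> //; apply: leq_trans cK _.
  have mono m k : M m <= M (m + k).
    by elim: k => [|k IHk]; rewrite ?addn0 // addnS (leq_trans IHk).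
  by have := mono s ((b * (E * E)).+1 - s); rewrite subnKC //; exact: ltnW.
right; have [K' [chi' [cK' en']]] := refine adj E chi.
exists K', chi'; split.
  by rewrite cK' /M iterS leq_mul // leq_exp2l.
have : b * (E * E * #|edgeless_pairs adj chi| + #|cls_pairs chi (bad adj E chi)|) <=
   b * (E * E * #|edgeless_pairs adj chi'|) by rewrite leq_mul2l en' orbT.
have assoc x : b * (E * E * x) = b * (E * E) * x by rewrite !mulnA.
rewrite mulnDr !assoc mulSn => le1.
by clear - le1 many en; lia.
Qed.

(** * Extremal numbers of the reduced graph *)

Section Graphs.
Variable V : finType.

Definition adjacent (G : sgraph V) : rel V := fun u v => [set u; v] \in edges G.

Lemma adjacent_sym G : symmetric (adjacent G).
Proof. by move=> u v; rewrite /adjacent setUC. Qed.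

Lemma edge_card2 (G : sgraph V) e : e \in edges G -> #|e| = 2.
Proof. by move=> eG; have := subsetP (edges_pairs G) e eG; rewrite inE => /eqP. Qed.

Lemma adjacent_neq G u v : adjacent G u v -> u != v.
Proof. by move=> /edge_card2; rewrite cards2; case: (u == v). Qed.

Lemma set2_eq (u v a b : V) : u != v ->
  ([set a; b] == [set u; v]) = ((a, b) \in [set (u, v); (v, u)]).
Proof.
move=> uv; rewrite !inE !xpair_eqE; apply/eqP/idP => [eq_uv|].
  have : a \in [set u; v] by rewrite -eq_uv !inE eqxx.
  have : b \in [set u; v] by rewrite -eq_uv !inE eqxx orbT.
  have : v \in [set a; b] by rewrite eq_uv !inE eqxx orbT.
  have : u \in [set a; b] by rewrite eq_uv !inE eqxx.
  rewrite !inE => h1 h2 /orP[/eqP eb|/eqP eb] /orP[/eqP ea|/eqP ea].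
  - by move: h2 uv; rewrite ea eb orbb => /eqP->; rewrite eqxx.
  - by rewrite ea eb !eqxx orbT.
  - by rewrite ea eb !eqxx.
  - by move: h1 uv; rewrite ea eb orbb => /eqP->; rewrite eqxx.
by case/orP => /andP[/eqP-> /eqP->] //; rewrite setUC.
Qed.

Definition arcs (G : sgraph V) : {set V * V} := [set uv | adjacent G uv.1 uv.2].

Lemma card_arcs G : #|arcs G| = 2 * num_edges G.
Proof.
rewrite -sum1_card (partition_big (fun uv => [set uv.1; uv.2]) [in edges G]) /=; last first.
  by move=> uv; rewrite inE.
rewrite mulnC -sum_nat_const; apply: eq_bigr => e eG.
have /eqP/cards2P[u [v [uv eE]]] := edge_card2 eG.
rewrite sum1_card (eq_card (B := [in [set (u, v); (v, u)]])) => [|[a b]].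
  by rewrite cards2 xpair_eqE negb_and uv.
rewrite [LHS]unfold_in inE /adjacent /=; case: eqP => [eq_e|neq_e].
  by rewrite eq_e eG -set2_eq // eq_e eE eqxx.
by rewrite andbF -set2_eq // -eE; apply/esym/eqP.
Qed.

Definition rel_edges (a : rel V) : {set {set V}} :=
  [set e in pairs V | [exists u, exists v, (e == [set u; v]) && a u v]].

Lemma rel_edges_pairs a : rel_edges a \subset pairs V.
Proof. by apply/subsetP => e; rewrite inE => /andP[]. Qed.

Definition rel_graph (a : rel V) : sgraph V := SGraph (rel_edges_pairs a).

Lemma rel_graphE (a : rel V) u v : symmetric a -> u != v ->
  adjacent (rel_graph a) u v = a u v.
Proof.
move=> asym uv; rewrite /adjacent /= !inE cards2 uv /=.
apply/existsP/idP => [[x /existsP[y]]|auv]; last first.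
  by exists u; apply/existsP; exists v; rewrite eqxx.
rewrite eq_sym set2_eq // !inE !xpair_eqE => /andP[/orP[]/andP[/eqP-> /eqP->]] //.
by rewrite asym.
Qed.

Lemma has_cycle_copy (F : sgraph V) c : cycle (adjacent F) c -> uniq c ->
  has_copy (cycle_graph (size c)) F.
Proof.
case: c => [|x0 c'] cc uc.
  apply/existsP; exists [ffun i : 'I_0 => match notF (valP i) with end].
  apply/andP; split; first by apply/injectiveP => -[].
  by apply/forall_inP => e; rewrite !inE => /andP[/imsetP[[]]].
set c := x0 :: c' in cc uc *.
apply/existsP; exists [ffun i : 'I_(size c) => nth x0 c i]; apply/andP; split.
  apply/injectiveP => i j; rewrite !ffunE => /eqP.
  by rewrite nth_uniq // => /eqP/val_inj.
apply/forall_inP => e; rewrite !inE => /andP[/imsetP[i _ ->] _].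
rewrite imsetU1 imset_set1 !ffunE; change (adjacent F (nth x0 c i) (nth x0 c (ordS i))).
have := next_cycle cc (mem_nth x0 (ltn_ord i)).
rewrite next_nth mem_nth // index_uniq //=.
have [lt_i|] := ltnP i.+1 (size c).
  by rewrite modn_small //= (set_nth_default x0).
move=> ge_i; have sz : size c' <= i by [].
have -> : i.+1 = size c by apply/eqP; rewrite eqn_leq ge_i ltn_ord.
by rewrite modnn (nth_default _ sz).
Qed.

Lemma copy_cycle (F : sgraph V) t' : 0 < t' -> has_copy (cycle_graph t'.+1) F ->
  exists f : 'I_t'.+1 -> V, injective f /\ forall s, adjacent F (f s) (f (ordS s)).
Proof.
move=> t0 /existsP[f /andP[/injectiveP inj_f /forall_inP fE]]; exists f; split=> // s.
have sS : s != ordS s.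
  apply/eqP => /(congr1 val) /= eq_s; move: (ltn_ord s); rewrite leq_eqVlt => /orP[/eqP eq_t|lt_t].
    by move: eq_s eq_t; case: (s : nat) => [|m] eq1 eq2; [move: t0; case: eq2 => <- | rewrite eq2 modnn in eq1].
  by rewrite modn_small // in eq_s; move: eq_s; clear; lia.
have := fE [set s; ordS s]; rewrite imsetU1 imset_set1; apply.
by rewrite !inE cards2 sS andbT; apply/imsetP; exists s.
Qed.

End Graphs.

(** * Trimming the blow-up and projecting its cycle *)

Section Reduction.
Variables (V K : finType) (F : sgraph V) (chi : V -> K) (E g y z : nat).
Local Notation cls := (cls chi).
Local Notation n := #|V|.

(** The lower bound on the class sizes ensures that, for large [n], every class in use has room for
    the logarithmic overheads. *)
Definition reduced i j :=
  [&& joinedb (adjacent F) E chi i j, n <= g * #|cls i| & n <= g * #|cls j|].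

Lemma reduced_joined i j : reduced i j -> joined (adjacent F) chi E i j.
Proof. by case/and3P => /joinedP. Qed.

Lemma reduced_sym : symmetric reduced.
Proof.
suff joined_sym i j : joinedb (adjacent F) E chi i j -> joinedb (adjacent F) E chi j i.
  by move=> i j; apply/and3P/and3P => -[J ? ?]; split=> //; apply: joined_sym.
move=> /joinedP J; apply/joinedP => A B sA sB cA cB.
have [u [v [uB vA uv]]] := J B A sB sA cB cA.
by exists v, u; split=> //; rewrite adjacent_sym.
Qed.

Definition core (I : {set K}) i j := [&& reduced i j, i \in I & j \in I].

Lemma core_sym I : symmetric (core I).
Proof. by move=> i j; rewrite /core reduced_sym [(i \in I) && _]andbC. Qed.

Definition rel_pairs (R : rel K) : {set V * V} := cls_pairs chi (fun ij => R ij.1 ij.2).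

Hypothesis V_gt0 : 0 < n.

(* Maximizing [y * pairs - 2 * n * vertices] makes every surviving class have
   large degree. *)
Lemma exists_core : exists I : {set K},
  {in live (core I), forall i, n <= y * \sum_(j | core I i j) #|cls j|} /\
  y * #|rel_pairs reduced| <= y * #|rel_pairs (core I)| + 2 * (n * n).
Proof.
pose out (I : {set K}) := [set v | chi v \notin I].
pose f (I : {set K}) := y * #|rel_pairs (core I)| + 2 * (n * #|out I|).
case: (@arg_maxnP _ [set: K] xpredT f) => // I _ maxI; exists I; split; last first.
  have := maxI [set: K] isT; rewrite /f.
  have -> : rel_pairs (core [set: K]) = rel_pairs reduced.
    by apply/setP => uv; rewrite !inE /core !inE !andbT.
  have : n * #|out I| <= n * n by rewrite leq_mul2l max_card orbT.
  have : n * #|out [set: K]| = 0.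
    by apply/eqP; rewrite muln_eq0 cards_eq0; apply/orP; right; apply/eqP/setP => v; rewrite !inE.
  by move: (y * _) (y * _) => a b; clear; lia.
move=> i; rewrite inE => /existsP[j0 /and3P[/and3P[_ big_i _] iI _]].
have ci : 0 < #|cls i| by move: big_i; case: #|cls i| => //; rewrite muln0; clear -V_gt0; lia.
set S := \sum_(j | _) _.
have := maxI (I :\ i) isT; rewrite /f.
have -> : #|out (I :\ i)| = #|out I| + #|cls i|.
  rewrite -cardsUI (_ : out I :&: cls i = set0) ?cards0 ?addn0; last first.
    by apply/setP => v; rewrite !inE; case: eqP => [->|]; rewrite ?iI ?andbF.
  apply: eq_card => v; rewrite !inE negb_and negbK orbC; by case: eqP.
(* Deleting [i] destroys only pairs with one end in [cls i] and the other in a related class, in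
   either order. *)
have le1 : #|rel_pairs (core I)| <= #|rel_pairs (core (I :\ i))| + 2 * (#|cls i| * S).
  pose X := \bigcup_(j | core I i j) cls j.
  have cX : #|X| <= S.
    rewrite /X /S; elim/big_rec2: _ => [|j m A _ le]; first by rewrite cards0.
    by apply: leq_trans (leq_card_setU _ _) _; rewrite leq_add2l.
  apply: leq_trans (_ : #|rel_pairs (core (I :\ i)) :|: setX (cls i) X :|: setX X (cls i)| <= _).
    apply/subset_leq_card/subsetP => -[u v].
    rewrite !inE /= => /and3P[Ruv uI vI]; rewrite /core !inE Ruv uI vI !andbT /=.
    case: (eqVneq (chi u) i) => [ui|_] /=.
      suff -> : v \in X by rewrite ?orbT.
      by apply/bigcupP; exists (chi v); rewrite ?inE // /core -ui Ruv uI.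
    case: (eqVneq (chi v) i) => [vi|_] //=; rewrite andbT; apply/bigcupP; exists (chi u); rewrite ?inE //.
    by rewrite /core -vi reduced_sym Ruv vI.
  apply: leq_trans (leq_card_setU _ _) _.
  have := (leq_card_setU (rel_pairs (core (I :\ i))) (setX (cls i) X)).1; rewrite !cardsX.
  have : #|cls i| * #|X| <= #|cls i| * S by rewrite leq_mul2l cX orbT.
  by rewrite [#|X| * _]mulnC; clear; lia.
have le2 : y * #|rel_pairs (core I)| <= y * (#|rel_pairs (core (I :\ i))| + 2 * (#|cls i| * S)).
  by rewrite leq_mul2l le1 orbT.
move=> le3; rewrite -(leq_pmul2l ci).
by move: le2 le3; rewrite !mulnDr; clear; lia.
Qed.

Variables (d h t' : nat).
Local Notation t := t'.+1.
Hypotheses (z_ge2 : 2 <= z) (y_gt0 : 0 < y) (d_ge2 : 2 <= d) (g_gt0 : 0 < g)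
  (E_large : 2000 * z * y * (d + 3) < E).
Hypothesis n_large : g * (E + 4 * z * (#|K| + 2 + overhead K h * (#|K| * #|K|) +
  final_slack K h)) <= n.
Hypotheses (h_small : forall r, r < h -> E * d ^ r <= 6 * n)
  (h_large : 6 * n <= E * d ^ h) (t_large : min_gap K h < t).
Hypothesis many_pairs :
  y * (2 * turan_ex (complete V) (cycle_graph t) + n + 2 * (n * (n %/ z + #|K|))) +
    2 * (n * n) < y * #|rel_pairs reduced|.

(** The blow-up on the untrimmed vertices has more edges than a graph without the cycle can have, so
    it contains one. Its image under [chi] is a closed walk, and injectivity of the copy bounds the
    visits to a class by the part that was not trimmed. *)
Theorem has_cycle_of_reduced : has_copy (cycle_graph t) F.
Proof.
have [I [deg le_core]] := exists_core.
pose R := core I; pose m i := #|cls i|.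
have liveI i : i \in live R -> n <= g * #|cls i|.
  by rewrite inE => /existsP[j /and3P[/and3P[_ ? _] _ _]].
have big i : i \in live R -> E <= m i /\
    4 * z * (#|K| + 2 + overhead K h * (#|K| * #|K|) + final_slack K h) <= m i.
  move=> /liveI le; have := leq_trans n_large le; rewrite leq_pmul2l // => le2.
  by split; apply: leq_trans le2; rewrite ?leq_addr ?leq_addl.
have E_ge2 : 2 <= E.
  apply: leq_trans E_large; rewrite ltnS -!mulnA muln_gt0 /=.
  by rewrite !muln_gt0 y_gt0 addn_gt0 orbT; clear -z_ge2; lia.
have /fin_all_exists[rm rmP] : forall i, exists S : {set V},
    i \in live R -> S \subset cls i /\ #|S| = (m i %/ z).+1.
  move=> i; case: (boolP (i \in live R)) => [/big[Ei _]|_]; last by exists set0.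
  have [|S sS cS] := @exists_subset_card _ (cls i) (m i %/ z).+1; last by exists S.
  by rewrite -/(m i) ltn_Pdiv //; apply: leq_trans (ltnW E_ge2) Ei.
pose Rm := \bigcup_(i in live R) rm i.
have cRm : #|Rm| <= n %/ z + #|K|.
  apply: leq_trans (_ : \sum_(i in live R) (m i %/ z).+1 <= _).
    rewrite /Rm; elim/big_rec2: _ => [|i k A il le]; first by rewrite cards0.
    apply: leq_trans (leq_card_setU _ _) _; apply: leq_add le.
    by have [_ ->] := rmP i il.
  under eq_bigr do rewrite -addn1.
  rewrite big_split /= sum1_card leq_add ?max_card //.
  rewrite leq_divRL ?(ltnW z_ge2) // big_distrl /=.
  apply: leq_trans (_ : \sum_(i in live R) #|[set: V] :&: cls i| <= _).
    by apply: leq_sum => i _; rewrite setTI leq_divM.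
  by rewrite -[leqRHS]cardsT sum_card_cls_le.
pose a u v := [&& u \notin Rm, v \notin Rm & R (chi u) (chi v)].
have a_sym : symmetric a by move=> u v; rewrite /a andbCA /R core_sym.
have many : turan_ex (complete V) (cycle_graph t) < num_edges (rel_graph a).
  rewrite -(ltn_pmul2l (isT : 0 < 2)) -card_arcs.
  (* The losses are the diagonal, since a class may be related to itself, and the pairs with an end
     in [Rm]. *)
  have le1 : #|rel_pairs R| <= #|arcs (rel_graph a)| + n + 2 * (n * (n %/ z + #|K|)).
    apply: leq_trans (_ : #|arcs (rel_graph a) :|: [set (u, u) | u : V] :|:
        (setX Rm [set: V] :|: setX [set: V] Rm)| <= _).
      apply/subset_leq_card/subsetP => -[u v]; rewrite !inE /= andbT => Ruv.
      case: (boolP (u \in Rm)) => uRm; first by rewrite !orbT.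
      case: (boolP (v \in Rm)) => vRm; first by rewrite !orbT.
      rewrite !orbF; case: (eqVneq u v) => [<-|uv]; first by rewrite imset_f ?orbT.
      by rewrite rel_graphE // /a uRm vRm Ruv.
    apply: leq_trans (leq_card_setU _ _) _; apply: leq_add.
      apply: leq_trans (leq_card_setU _ _) _; rewrite leq_add2l.
      exact: leq_imset_card.
    apply: leq_trans (leq_card_setU _ _) _; rewrite !cardsX cardsT.
    have : n * #|Rm| <= n * (n %/ z + #|K|) by rewrite leq_mul2l cRm orbT.
    by rewrite [#|Rm| * n]mulnC; clear; lia.
  have lt2 := leq_trans many_pairs le_core.
  move: lt2; rewrite -addSn leq_add2r ltn_pmul2l // => lt2.
  by have := leq_trans lt2 le1; clear; lia.
have copy : has_copy (cycle_graph t) (rel_graph a).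
  apply: contraLR many => no; rewrite -leqNgt.
  by apply: (leq_bigmax_cond (rel_graph a)); rewrite no rel_edges_pairs.
have t'0 : 0 < t' by move: t_large; rewrite /min_gap; clear; lia.
have [f [inj_f fE]] := copy_cycle t'0 copy.
have fa s : a (f s) (f (ordS s)) by rewrite -rel_graphE // (adjacent_neq (fE s)).
pose c s := chi (f s).
have Rc s : R (c s) (c (ordS s)) by have /and3P[] := fa s.
have [||cyc [sc cc uc]] := @cycle_of_closed_walk V K (adjacent F) chi R E _ (@core_sym I)
    (@adjacent_sym V F) t' c Rc y z d h (ltnW z_ge2) y_gt0 V_gt0 d_ge2 E_large deg _ big
    h_small h_large t_large.
- by move=> i j /and3P[/reduced_joined].
- move=> i il; have [sub crm] := rmP i il.
  have le1 : visits c i + (m i %/ z).+1 <= m i.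
    rewrite -crm /m /visits -(card_imset _ inj_f) -(cardsID (rm i) (cls i)) (setIidPr sub) addnC leq_add2l.
    apply/subset_leq_card/subsetP => v /imsetP[s]; rewrite inE => cs ->.
    rewrite !inE -/(c s) cs andbT; have /and3P[vRm _ _] := fa s.
    by apply: contra vRm => vr; apply/bigcupP; exists i.
  have le2 : z * (visits c i + (m i %/ z).+1) <= z * m i by rewrite leq_mul2l le1 orbT.
  apply: leq_trans le2; rewrite mulnDr leq_add2l mulnC.
  by apply: ltnW; apply: ltn_ceil; apply: ltnW.
- by rewrite -sc; apply: has_cycle_copy.
Qed.

End Reduction.

Import Order.TTheory GRing.Theory Num.Theory.
Local Open Scope ring_scope.

(** * Pseudorandomness of the binomial random graph *)

Section ExpBounds.
Variable R : realType.

Lemma expR_le_quad (x : R) : 0 <= x <= 1 / 2 -> expR x <= 1 + x + 2 * x ^+ 2.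
Proof.
case/andP=> x0 x1; have := expR_ge1Dx (- x); rewrite expRN => le1.
have e0 := expR_gt0 x.
have : (1 - x) * expR x <= 1.
  by have := ler_wpM2r (ltW e0) le1; rewrite mulVf ?lt0r_neq0.
nra.
Qed.

Lemma expRN_le_quad (x : R) : 0 <= x -> expR (- x) <= 1 - x + x ^+ 2.
Proof.
move=> x0; have le1 := expR_ge1Dx x; have e0 := expR_gt0 (- x).
have : (1 + x) * expR (- x) <= 1.
  by have := ler_wpM2r (ltW e0) le1; rewrite -expRD subrr expR0.
nra.
Qed.

End ExpBounds.

Lemma bin2R (R : realFieldType) n : (0 < n)%N -> 'C(n, 2)%:R = n%:R * (n%:R - 1) / 2 :> R.
Proof.
move=> n0; have := mul_bin_diag n 1; rewrite bin1 => /(congr1 (fun k => k%:R : R)).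
by rewrite !natrM -subn1 natrB // => eq_bin; rewrite eq_bin; field.
Qed.

Section RandomGraph.
Variables (R : realType) (n : nat) (p : R).
Hypotheses (p_ge0 : 0 <= p) (p_le1 : p <= 1).
Local Notation Pr := (@Gnp_prob R n p).

Lemma Gnp_mgf (y : {set 'I_n} -> R) :
  \sum_(G : sgraph 'I_n) Gnp_weight p G * \prod_(e in edges G) y e =
  \prod_(e in pairs 'I_n) (p * y e + (1 - p)).
Proof.
pose F e := if e \in pairs 'I_n then p * y e else 0.
pose H e : R := if e \in pairs 'I_n then 1 - p else 1.
transitivity (\sum_(J : {set {set 'I_n}}) \prod_e (if e \in J then F e else H e)); last first.
  rewrite -bigA_distr [RHS]big_mkcond /=; apply: eq_bigr => e _.
  by rewrite /F /H; case: ifP => // _; rewrite add0r.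
(* The expanded product ranges over all families of vertex sets; [F] vanishes off [pairs], so only
   edge sets of graphs contribute. *)
rewrite (bigID (fun J : {set {set 'I_n}} => J \subset pairs 'I_n)) /= [X in _ + X]big1 ?addr0; last first.
  move=> J /subsetPn[e eJ ne]; rewrite (bigD1 e) //= eJ /F (negPf ne).
  by rewrite mul0r.
rewrite (reindex_omap (@edges 'I_n) insub) /=; last by move=> J sJ; rewrite insubT.
rewrite [RHS](eq_bigl xpredT); last by move=> G; rewrite edges_pairs valK eqxx.
apply: eq_bigr => G _; rewrite /Gnp_weight big_mkcond [X in _ * X]big_mkcond -big_split /=.
apply: eq_bigr => e _; rewrite /F /H.
case: (boolP (e \in edges G)) => [eG|_]; last by rewrite mulr1.
by rewrite (subsetP (edges_pairs G) e eG).
Qed.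

Lemma Gnp_weight_ge0 (G : sgraph 'I_n) : 0 <= Gnp_weight p G.
Proof. by apply: prodr_ge0 => e _; case: ifP => _ //; rewrite subr_ge0. Qed.

Lemma sum_Gnp_weight : \sum_(G : sgraph 'I_n) Gnp_weight p G = 1.
Proof.
have := Gnp_mgf (fun=> 1); rewrite [RHS]big1 => [<-|e _]; last by rewrite mulr1 addrC subrK.
by apply: eq_bigr => G _; rewrite big1 // mulr1.
Qed.

Lemma Gnp_prob_compl (A : pred (sgraph 'I_n)) : Pr A = 1 - Pr (predC A).
Proof. by rewrite -sum_Gnp_weight (bigID A) /= addrK. Qed.

Lemma Gnp_prob_sub (A B : pred (sgraph 'I_n)) : {subset A <= B} -> Pr A <= Pr B.
Proof.
move=> sAB; rewrite /Gnp_prob [leLHS]big_mkcond [leRHS]big_mkcond.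
apply: ler_sum => G _; have := sAB G; rewrite !unfold_in.
by case: (A G) => [->//|_]; case: (B G); rewrite ?Gnp_weight_ge0.
Qed.

Lemma Gnp_prob_or (A B : pred (sgraph 'I_n)) : Pr (predU A B) <= Pr A + Pr B.
Proof.
rewrite /Gnp_prob big_mkcond [X in _ <= X + _]big_mkcond [X in _ <= _ + X]big_mkcond -big_split /=.
apply: ler_sum => G _; have := Gnp_weight_ge0 G.
by case: (A G); case: (B G); rewrite /= ?addr0 ?add0r // => w0; rewrite lerDl.
Qed.

Lemma Gnp_prob_exists (I : finType) (A : I -> pred (sgraph 'I_n)) :
  Pr (fun G => [exists i, A i G]) <= \sum_i Pr (A i).
Proof.
rewrite /Gnp_prob big_mkcond.
have -> : \sum_i \sum_(G | A i G) Gnp_weight p G =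
    \sum_G \sum_(i | A i G) Gnp_weight p G.
  by rewrite (exchange_big_dep xpredT).
apply: ler_sum => G _; case: ifP => [/existsP[i AiG]|_].
  by rewrite (bigD1 i) //= lerDl sumr_ge0 // => *; exact: Gnp_weight_ge0.
by rewrite sumr_ge0 // => *; exact: Gnp_weight_ge0.
Qed.

(** Chernoff's argument for a weighted number of edges: Markov's inequality for the exponential
    moment, computed by [Gnp_mgf]. The sign of [s] is free, so both tails are covered. *)
Lemma Gnp_tail (c : {set 'I_n} -> nat) (s k thr : R) :
  (forall e, e \in pairs 'I_n -> expR (s * (c e)%:R) - 1 <= k * (c e)%:R) ->
  Pr (fun G => thr <= s * (\sum_(e in edges G) c e)%N%:R) <=
  expR (p * k * (\sum_(e in pairs 'I_n) c e)%N%:R - thr).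
Proof.
move=> hk; pose y e := expR (s * (c e)%:R).
apply: (@le_trans _ _ (expR (- thr) * \prod_(e in pairs 'I_n) (p * y e + (1 - p)))).
  rewrite -Gnp_mgf big_distrr /= /Gnp_prob big_mkcond /=; apply: ler_sum => G _.
  have w0 := Gnp_weight_ge0 G.
  have yE : \prod_(e in edges G) y e = expR (s * (\sum_(e in edges G) c e)%N%:R).
    by rewrite natr_sum big_distrr /= expR_sum.
  rewrite yE mulrCA -expRD; case: ifP => [le_thr|_].
    by rewrite ler_peMr // -[leLHS]expR0 ler_expR addrC subr_ge0.
  by rewrite mulr_ge0 // expR_ge0.
rewrite [leRHS]expRD [leRHS]mulrC ler_wpM2l ?expR_ge0 // natr_sum big_distrr /= expR_sum.
apply: ler_prod => e eP; apply/andP; split.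
  by rewrite addr_ge0 ?subr_ge0 // mulr_ge0 // expR_ge0.
apply: le_trans (expR_ge1Dx _).
have := ler_wpM2l p_ge0 (hk e eP); rewrite /y; lra.
Qed.

(** [A] and [B] may overlap, and an edge inside the intersection counts as two arcs. With this
    weight arcs become a weighted sum over independent edges. *)
Definition mult (A B : {set 'I_n}) (e : {set 'I_n}) : nat :=
  #|[set uv : 'I_n * 'I_n | [&& uv.1 \in A, uv.2 \in B & [set uv.1; uv.2] == e]]|.

Definition arcs_between (G : sgraph 'I_n) (A B : {set 'I_n}) : nat :=
  #|[set uv : 'I_n * 'I_n | [&& uv.1 \in A, uv.2 \in B & adjacent G uv.1 uv.2]]|.

Lemma sum_mult (A B : {set 'I_n}) (S : {set {set 'I_n}}) :
  (\sum_(e in S) mult A B e)%N =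
  #|[set uv : 'I_n * 'I_n | [&& uv.1 \in A, uv.2 \in B & [set uv.1; uv.2] \in S]]|.
Proof.
rewrite -sum1_card (partition_big (fun uv => [set uv.1; uv.2]) [in S]) /=; last first.
  by move=> uv; rewrite inE => /and3P[].
apply: eq_bigr => e eS; rewrite sum1_card; apply: eq_card => uv.
rewrite [RHS]unfold_in !inE -!andbA; case: (_ \in A); case: (_ \in B) => //=.
by case: eqP => [->|]; rewrite ?eS ?andbF.
Qed.

Lemma arcs_betweenE G A B : arcs_between G A B = (\sum_(e in edges G) mult A B e)%N.
Proof. by rewrite sum_mult. Qed.

Lemma sum_mult_pairs A B : (\sum_(e in pairs 'I_n) mult A B e <= #|A| * #|B|)%N.
Proof.
rewrite sum_mult -cardsX; apply/subset_leq_card/subsetP => uv.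
by rewrite !inE => /and3P[-> ->].
Qed.

Lemma mult_le2 A B e : e \in pairs 'I_n -> (mult A B e <= 2)%N.
Proof.
rewrite inE => /cards2P[u [v [uv ->]]].
apply: leq_trans (_ : #|[set (u, v); (v, u)]| <= 2)%N; last by rewrite cards2; case: (_ != _).
apply/subset_leq_card/subsetP => -[a b]; rewrite inE => /and3P[_ _].
by rewrite /= set2_eq.
Qed.

Lemma arcs_upper_tail (A B : {set 'I_n}) (delta : R) : 0 < delta <= 1 ->
  Pr (fun G => (1 + delta) * p * (#|A| * #|B|)%N%:R <= (arcs_between G A B)%:R) <=
  expR (- (delta ^+ 2 / 16 * p * (#|A| * #|B|)%N%:R)).
Proof.
(* Weights up to 2 cost [s + 4 * s ^+ 2] per unit, and [s = delta / 8] minimizes the exponent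
   [4 * s ^+ 2 - s * delta], giving [- delta ^+ 2 / 16]. *)
case/andP=> d0 d1; pose s := delta / 8.
have s0 : 0 < s by rewrite divr_gt0.
set m := (#|A| * #|B|)%N.
have hk e : e \in pairs 'I_n ->
    expR (s * (mult A B e)%:R) - 1 <= (s + 4 * s ^+ 2) * (mult A B e)%:R.
  move=> /(mult_le2 A B); case: (mult A B e) => [|[|[|//]]] _.
  - by rewrite !mulr0 expR0 subrr.
  - by have := @expR_le_quad R s _; rewrite !mulr1; have := sqr_ge0 s; rewrite /s in s0 *; nra.
  - have := @expR_le_quad R (s * 2) _; have := sqr_ge0 s; rewrite /s in s0 *; nra.
apply: (@le_trans _ _ (Pr (fun G => s * ((1 + delta) * p * m%:R) <= s * (\sum_(e in edges G) mult A B e)%N%:R))).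
  by apply: Gnp_prob_sub => G; rewrite !unfold_in arcs_betweenE ler_pM2l.
apply: le_trans (Gnp_tail _ hk) _; rewrite ler_expR.
have le1 : (\sum_(e in pairs 'I_n) mult A B e)%N%:R <= m%:R :> R by rewrite ler_nat sum_mult_pairs.
have k0 : 0 <= p * (s + 4 * s ^+ 2) by apply: mulr_ge0 => //; have := sqr_ge0 s; move: s0; lra.
have := ler_wpM2l k0 le1; set pm := p * m%:R.
have -> : p * (s + 4 * s ^+ 2) * m%:R = (s + 4 * s ^+ 2) * pm by rewrite /pm; ring.
have -> : s * ((1 + delta) * p * m%:R) = s * (1 + delta) * pm by rewrite /pm; ring.
have -> : delta ^+ 2 / 16 * p * m%:R = delta ^+ 2 / 16 * pm by rewrite /pm; ring.
have -> : (s + 4 * s ^+ 2) * pm = s * (1 + delta) * pm - delta ^+ 2 / 16 * pm.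
  by rewrite /s; field.
lra.
Qed.

Lemma edges_lower_tail (delta : R) : 0 < delta <= 1 ->
  Pr (fun G => (num_edges G)%:R <= (1 - delta) * p * 'C(n, 2)%:R) <=
  expR (- (delta ^+ 2 / 4 * p * 'C(n, 2)%:R)).
Proof.
case/andP=> d0 d1; pose s := delta / 2; have s0 : 0 < s by rewrite divr_gt0.
have hk e : e \in pairs 'I_n -> expR (- s * 1%:R) - 1 <= (- s + s ^+ 2) * 1%:R.
  by move=> _; rewrite !mulr1; have := expRN_le_quad (ltW s0); lra.
apply: (@le_trans _ _ (Pr (fun G => - s * ((1 - delta) * p * 'C(n, 2)%:R) <= - s * (\sum_(e in edges G) 1)%N%:R))).
  by apply: Gnp_prob_sub => G; rewrite !unfold_in sum1_card !mulNr lerN2 ler_pM2l.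
apply: le_trans (Gnp_tail _ hk) _; rewrite ler_expR.
have -> : (\sum_(e in pairs 'I_n) 1)%N = 'C(n, 2).
  by rewrite sum1_card /pairs card_draws card_ord.
by rewrite le_eqVlt; apply/orP; left; apply/eqP; rewrite /s; field.
Qed.

Definition pseudorandom (g : nat) (delta : R) (G : sgraph 'I_n) : bool :=
  [forall A : {set 'I_n}, forall B : {set 'I_n},
     ((n <= g * #|A|)%N && (n <= g * #|B|)%N) ==>
     ((arcs_between G A B)%:R <= (1 + delta) * p * (#|A| * #|B|)%N%:R)] &&
  ((1 - delta) * p * 'C(n, 2)%:R <= (num_edges G)%:R).

(** A union bound over the [4 ^ n] pairs of sets. For large sets the exponent
    [delta ^+ 2 / 16 * p * #|A| * #|B|] is at least [4 * n], and [4 ^ n] is at most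
    [expR (2 * n)]. *)
Lemma pseudorandom_prob (g : nat) (delta x : R) : (0 < g)%N -> 0 < delta <= 1 ->
  (1 < n)%N -> 64 * g%:R ^+ 2 <= delta ^+ 2 * x -> x / n%:R <= p ->
  1 - expR (- n%:R) <= Pr (pseudorandom g delta).
Proof.
move=> g0 d01 n1 hx hp; have [d0 d1] := andP d01.
have n0 : 0 < n%:R :> R by rewrite ltr0n ltnW.
have gR : 1 <= g%:R :> R by rewrite ler1n.
have hpn : x <= p * n%:R by rewrite -ler_pdivrMr.
have dx : delta ^+ 2 * x <= delta ^+ 2 * (p * n%:R) by rewrite ler_wpM2l ?sqr_ge0.
pose up (AB : {set 'I_n} * {set 'I_n}) : pred (sgraph 'I_n) := fun G =>
  [&& (n <= g * #|AB.1|)%N, (n <= g * #|AB.2|)%N &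
    (1 + delta) * p * (#|AB.1| * #|AB.2|)%N%:R <= (arcs_between G AB.1 AB.2)%:R].
pose low : pred (sgraph 'I_n) := fun G => (num_edges G)%:R <= (1 - delta) * p * 'C(n, 2)%:R.
rewrite Gnp_prob_compl lerD2l lerN2.
have le_union : Pr (predC (pseudorandom g delta)) <=
    \sum_AB Pr (up AB) + Pr low.
  apply: (@le_trans _ _ (Pr (predU (fun G => [exists AB, up AB G]) low))); last first.
    by apply: le_trans (Gnp_prob_or _ _) _; rewrite lerD2r; apply: Gnp_prob_exists.
  apply: Gnp_prob_sub => G; rewrite !unfold_in /= negb_and => /orP[|nlow]; last first.
    by rewrite [low G]ltW ?orbT // ltNge.
  rewrite negb_forall => /existsP[A]; rewrite negb_forall => /existsP[B].
  rewrite negb_imply => /andP[/andP[cA cB] nle]; apply/orP; left; apply/existsP; exists (A, B).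
  by rewrite /up /= cA cB ltW // ltNge.
apply: le_trans le_union _.
have upE AB : Pr (up AB) <= expR (- (4 * n%:R)).
  case: (boolP ((n <= g * #|AB.1|)%N && (n <= g * #|AB.2|)%N)) => [/andP[cA cB]|ncAB]; last first.
    rewrite /Gnp_prob big1 ?expR_ge0 // => G; rewrite /up andbA; by case: (_ && _) ncAB.
  apply: (@le_trans _ _ (Pr (fun G => (1 + delta) * p * (#|AB.1| * #|AB.2|)%N%:R <= (arcs_between G AB.1 AB.2)%:R))).
    by apply: Gnp_prob_sub => G; rewrite !unfold_in => /and3P[].
  apply: le_trans (arcs_upper_tail _ _ d01) _; rewrite ler_expR lerN2.
  have n2 : n%:R * n%:R <= g%:R ^+ 2 * (#|AB.1| * #|AB.2|)%N%:R :> R.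
    rewrite -natrX -!natrM ler_nat.
    by apply: leq_trans (leq_mul cA cB) _; rewrite expnS expn1 mulnACA.
  set m := (_ * _)%N%:R in n2 *.
  have p0 := p_ge0.
  have : (4 * n%:R) * (16 * g%:R ^+ 2) <= (delta ^+ 2 / 16 * p * m) * (16 * g%:R ^+ 2).
    have c0 : 0 <= delta ^+ 2 * p by rewrite mulr_ge0 ?sqr_ge0.
    have := ler_wpM2l c0 n2; have := ler_wpM2r (ltW n0) (le_trans hx dx).
    have -> : delta ^+ 2 / 16 * p * m * (16 * g%:R ^+ 2) = delta ^+ 2 * p * (g%:R ^+ 2 * m) by field.
    lra.
  by rewrite ler_pM2r // mulr_gt0 // exprn_gt0 // ltr0n.
have lowE : Pr low <= expR (- (4 * n%:R)).
  apply: le_trans (edges_lower_tail d01) _; rewrite ler_expR lerN2.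
  have n2 : 2 <= n%:R :> R by rewrite (ler_nat R 2).
  rewrite bin2R ?(ltnW n1) //.
  have -> : delta ^+ 2 / 4 * p * (n%:R * (n%:R - 1) / 2) =
    delta ^+ 2 * (p * n%:R) * (n%:R - 1) / 8 by field.
  have : 64 <= delta ^+ 2 * (p * n%:R).
    apply: le_trans dx; apply: le_trans hx.
    by rewrite ler_peMr // exprn_ege1.
  set w := delta ^+ 2 * _ => w64.
  have : 64 * (n%:R - 1) <= w * (n%:R - 1) by rewrite ler_wpM2r // subr_ge0; lra.
  lra.
have : \sum_AB Pr (up AB) <= 4 ^+ n * expR (- (4 * n%:R)).
  apply: (@le_trans _ _ (\sum_(AB : {set 'I_n} * {set 'I_n}) expR (- (4 * n%:R)))).
    by apply: ler_sum => AB _.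
  rewrite sumr_const card_prod -[leLHS]mulr_natl ler_wpM2r ?expR_ge0 //.
  have -> : #|{set 'I_n}| = (2 ^ n)%N by rewrite -cardsT -powersetT card_powerset cardsT card_ord.
  by rewrite natrM !natrX -exprMn -natrM.
have e1 : 2 <= expR (n%:R : R).
  have n2 : 2 <= n%:R :> R by rewrite (ler_nat R 2).
  by apply: le_trans (expR_ge1Dx _); lra.
have e4 : 4 ^+ n <= expR (n%:R : R) ^+ 2.
  have -> : expR n%:R = expR 1 ^+ n :> R by rewrite -expRM_natl mulr1.
  have e2 : 2 <= expR (1 : R) by apply: le_trans (expR_ge1Dx _); lra.
  rewrite exprAC; apply: lerXn2r; rewrite ?nnegrE ?exprn_ge0 ?expR_ge0 //; nra.
have eN : expR (- (4 * n%:R)) = expR (- n%:R) ^+ 4 :> R.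
  by rewrite -expRM_natl mulrN.
move: lowE; rewrite eN; have : expR (n%:R : R) * expR (- n%:R) = 1 by rewrite -expRD subrr expR0.
move: e1 e4; set a := expR n%:R; set b := expR (- n%:R) => e1 e4 ab h1 h2.
have b0 : 0 < b by apply: expR_gt0.
have b2 : b <= 1 / 2 by nra.
have b4 : b ^+ 4 = b ^+ 2 * b ^+ 2 by ring.
have : 4 ^+ n * b ^+ 4 <= b ^+ 2.
  have -> : b ^+ 2 = a ^+ 2 * b ^+ 4 by rewrite b4 mulrA -exprMn ab expr1n mul1r.
  by rewrite ler_wpM2r // exprn_ge0 // ltW.
have : b ^+ 4 <= b ^+ 2 by rewrite b4 ler_piMr ?sqr_ge0 // exprn_ile1 // ltW //; lra.
have : b ^+ 2 <= b * (1 / 2) by rewrite expr2 ler_wpM2l // ltW.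
lra.
Qed.

End RandomGraph.

(** * Transference *)

Lemma exists_depth (E d n : nat) : (2 <= d)%N -> (6 <= E)%N -> (0 < n)%N ->
  exists h, [/\ forall r, (r < h)%N -> (E * d ^ r <= 6 * n)%N,
    (6 * n <= E * d ^ h)%N & (d ^ h.-1 <= n)%N].
Proof.
move=> d2 E6 n0; have exP : exists h, (6 * n <= E * d ^ h)%N.
  exists n; apply: leq_mul => //; apply: leq_trans (ltnW (ltn_expl n d2)) _; exact: leqnn.
case: (ex_minnP exP) => h hP hmin.
have small r : (r < h)%N -> (E * d ^ r < 6 * n)%N.
  by move=> rh; rewrite ltnNge; apply/negP => /hmin; rewrite leqNgt rh.
exists h; split=> //; first by move=> r /small/ltnW.
case: h {hP hmin} small => [|h] small; first by rewrite expn0.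
have := small h (ltnSn h); have : (6 * d ^ h <= E * d ^ h)%N by rewrite leq_mul2r E6 orbT.
by rewrite /=; clear; lia.
Qed.

(** A logarithm is below the square root: [h.+1 ^ 2 <= 8 * 2 ^ h.-1 <= 8 * n]. This replaces any
    appeal to limits when overheads linear in [h] must fit into a class. *)
Lemma depth_small (c d h n : nat) : (2 <= d)%N -> (d ^ h.-1 <= n)%N ->
  (8 * c ^ 2 <= n)%N -> (c * h.+1 <= n)%N.
Proof.
move=> d2 dn cn; have sq k : (k.+2 ^ 2 <= 8 * 2 ^ k)%N.
  elim: k => [//|[//|k] IH]; rewrite expnS mulnCA.
  apply: leq_trans (leq_mul (leqnn 2) IH); rewrite -!mulnn; clear; nia.
have le2 : (2 ^ h.-1 <= n)%N by apply: leq_trans dn; case: h.-1 => // k; rewrite leq_exp2r.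
have h2 : (h.+1 ^ 2 <= 8 * n)%N.
  case: h le2 {dn} => [|h] le2; first by rewrite muln_gt0; apply: leq_trans le2.
  by apply: leq_trans (sq h) _; rewrite leq_mul2l le2 orbT.
rewrite -leq_sqr expnMn.
apply: leq_trans (leq_mul (leqnn (c ^ 2)) h2) _; rewrite mulnCA mulnA -mulnn.
by rewrite leq_mul2r cn orbT.
Qed.

Section Counting.
Variables (R : realType) (n : nat) (p delta : R) (g M s : nat).
Variables (G F : sgraph 'I_n) (K : finType) (chi : 'I_n -> K) (E : nat).
Hypotheses (FG : edges F \subset edges G) (prG : pseudorandom p g delta G).
Hypotheses (p_ge0 : 0 <= p) (delta_gt0 : 0 < delta) (g_gt0 : (0 < g)%N)
  (cK : (#|K| <= M)%N) (M_gt0 : (0 < M)%N) (sE : s = (M * n %/ g).+1)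
  (s_le : (s <= n)%N).
Local Notation big i := (#|'I_n| <= g * #|cls chi i|)%N.

Lemma arcs_count : (#|arcs F|%:R : R) <= (1 + delta) * p *
  (#|rel_pairs chi (reduced F chi E g)| +
   #|cls_pairs chi (bad (adjacent F) E chi)| + 4 * (s * n))%N%:R.
Proof.
have prAB (A B : {set 'I_n}) : (n <= g * #|A|)%N -> (n <= g * #|B|)%N ->
    (arcs_between G A B)%:R <= (1 + delta) * p * (#|A| * #|B|)%N%:R.
  by move=> cA cB; have /andP[/forallP/(_ A)/forallP/(_ B)] := prG; rewrite cA cB.
have subFG u v : adjacent F u v -> adjacent G u v by apply: (subsetP FG).
have gs : (M * n <= g * s)%N by rewrite sE [leqRHS]mulnC; apply: ltnW; apply: ltn_ceil.
pose small := [set v | ~~ big (chi v)].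
have c_small : (#|small| <= s)%N.
  rewrite -(leq_pmul2l g_gt0); apply: leq_trans gs.
  rewrite -(sum_card_cls chi small) big_distrr /=.
  apply: leq_trans (_ : \sum_(i : K) n <= _)%N; last first.
    by rewrite sum_nat_const leq_mul2r cK orbT.
  apply: leq_sum => i _; case: (boolP (big i)) => bi.
    rewrite (_ : small :&: _ = set0) ?cards0 ?muln0 //; apply/setP => v; rewrite !inE.
    by case: eqP => [->|]; rewrite ?bi ?andbF.
  rewrite -[leqRHS]card_ord; apply: ltnW; move: bi; rewrite -ltnNge; apply: leq_ltn_trans.
  by rewrite leq_mul2l subset_leq_card ?orbT // subsetIr.
(* The union of the small classes may be too small for pseudorandomness to speak about it; it is
   padded with [s] arbitrary vertices. *)
have [|S0 _ cS0] := @exists_subset_card _ [set: 'I_n] s; first by rewrite cardsT card_ord.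
pose Sm := small :|: S0.
have c_Sm : (#|Sm| <= 2 * s)%N.
  by apply: leq_trans (leq_card_setU _ _) _; rewrite cS0 mul2n -addnn leq_add2r.
have g_Sm : (n <= g * #|Sm|)%N.
  apply: leq_trans (leq_trans (leq_pmull n M_gt0) gs) _; rewrite leq_mul2l -cS0.
  by rewrite subset_leq_card ?orbT // subsetUr.
have g_T : (n <= g * #|[set: 'I_n]|)%N by rewrite cardsT card_ord leq_pmull.
pose Q (ij : K * K) := [&& ~~ edgeless (adjacent F) chi ij.1 ij.2, big ij.1 & big ij.2].
pose A1 := [set uv in arcs F | Q (chi uv.1, chi uv.2)].
have le_arcs : (#|arcs F| <= #|A1| + (arcs_between G Sm [set: 'I_n] + arcs_between G [set: 'I_n] Sm))%N.
  apply: leq_trans (_ : #|A1 :|: ([set uv : 'I_n * 'I_n | [&& uv.1 \in Sm, uv.2 \in [set: 'I_n] & adjacent G uv.1 uv.2]] :|: [set uv : 'I_n * 'I_n | [&& uv.1 \in [set: 'I_n], uv.2 \in Sm & adjacent G uv.1 uv.2]])| <= _)%N.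
    apply/subset_leq_card/subsetP => -[u v]; rewrite !inE /= => uv.
    rewrite uv (subFG u v uv) !andbT /Q /=.
    case: (boolP (big (chi u))) => bu /=; last by rewrite ?orbT.
    case: (boolP (big (chi v))) => bv /=; last by rewrite ?orbT.
    rewrite andbT; suff -> : ~~ edgeless (adjacent F) chi (chi u) (chi v) by [].
    apply/negP => /forallP/(_ u); rewrite inE eqxx /= => /forallP/(_ v).
    by rewrite inE eqxx uv.
  apply: leq_trans (leq_card_setU _ _) _; rewrite leq_add2l.
  exact: (leq_card_setU _ _).1.
have A1E : (#|A1| <= \sum_(ij | Q ij) arcs_between G (cls chi ij.1) (cls chi ij.2))%N.
  rewrite -sum1_card (partition_big (fun uv => (chi uv.1, chi uv.2)) Q) /=; last first.
    by move=> uv; rewrite inE => /andP[].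
  apply: leq_sum => ij _; rewrite sum1_card; apply/subset_leq_card/subsetP => uv.
  rewrite unfold_in inE => /andP[+ /eqP <-]; rewrite !inE => /andP[uvF _].
  by rewrite !eqxx /=; apply: subFG.
have c0 : 0 <= (1 + delta) * p by rewrite mulr_ge0 // addr_ge0 // ltW.
have A1R : (#|A1|%:R : R) <= (1 + delta) * p * (#|rel_pairs chi (reduced F chi E g)| +
   #|cls_pairs chi (bad (adjacent F) E chi)|)%N%:R.
  apply: (@le_trans _ _ (\sum_(ij | Q ij) (1 + delta) * p * (#|cls chi ij.1| * #|cls chi ij.2|)%N%:R)).
    move: A1E; rewrite -(ler_nat R) => /le_trans; apply; rewrite natr_sum.
    by apply: ler_sum => ij /and3P[_]; rewrite card_ord => b1 b2; apply: prAB.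
  rewrite -big_distrr /= -natr_sum ler_wpM2l // ler_nat.
  rewrite /rel_pairs !card_cls_pairs.
  rewrite [X in (_ <= X + _)%N]big_mkcond [X in (_ <= _ + X)%N]big_mkcond -big_split [leqLHS]big_mkcond /=.
  apply: leq_sum => ij _; case: ifP => // /and3P[ne b1 b2].
  rewrite /reduced /bad ne b1 b2 !andbT /=.
  by case: (joinedb _ _ _ _ _); rewrite /= ?addn0.
have SmR : ((#|Sm| * n)%N%:R : R) <= (2 * (s * n))%N%:R.
  by rewrite ler_nat mulnA leq_mul2r c_Sm orbT.
have b1 := prAB Sm [set: 'I_n] g_Sm g_T; have b2 := prAB [set: 'I_n] Sm g_T g_Sm.
rewrite cardsT card_ord in b1 b2; rewrite [(n * _)%N]mulnC in b2.
have {SmR} := ler_wpM2l c0 SmR; set X := _ * (2 * (s * n))%N%:R => b3.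
rewrite (_ : 4 * (s * n) = 2 * (s * n) + 2 * (s * n))%N; last by clear; lia.
rewrite [(_ + (_ + _))%N%:R]natrD mulrDr [(_ + _)%N%:R in X in _ + X]natrD [_ * (_ + _) in X in _ + X]mulrDr -/X.
apply: le_trans (_ : _ <= #|A1|%:R + ((arcs_between G Sm [set: 'I_n])%:R + (arcs_between G [set: 'I_n] Sm)%:R)) _.
  by rewrite -!natrD ler_nat.
by apply: lerD => //; apply: lerD; [exact: le_trans b1 b3 | exact: le_trans b2 b3].
Qed.
End Counting.

(** With [u = n ^+ 2 / b], the term [2 * beta * m] is worth at least [u - n]. Against it stand
    [u / 16] for bad pairs, about [u / 16] for small classes, [u / 8] from [delta * ex] on both
    sides, relative losses of [1 / 16], lower-order terms, and the surplus [u / 4] to be left over,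
    which is the [4 * n ^+ 2] of the conclusion. *)
Lemma pairs_gap (R : realFieldType) (b n M ex Q B s beta delta m : R) :
  1 <= b -> 1 <= n -> 0 <= M -> 1 / b <= beta -> delta = 1 / (16 * b) ->
  0 <= ex -> ex <= m -> m = n * (n - 1) / 2 -> 0 <= B -> 16 * b * B <= n ^+ 2 ->
  0 <= s -> 64 * b * (s - 1) <= n -> 3 * b * (7 + 2 * M) <= n ->
  2 * (1 - delta) * (ex + beta * m) < (1 + delta) * (Q + B + 4 * (s * n)) ->
  16 * b * (2 * ex + n + 2 * (n * M)) + 4 * n ^+ 2 < 16 * b * Q.
Proof.
move=> b1 n1 M0 hbeta hdelta ex0 exm mE B0 hB s0 hs hn lt.
have b0 : 0 < b by lra.
pose u := n ^+ 2 / b.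
have uE : n ^+ 2 = b * u by rewrite /u mulrC divfK // lt0r_neq0.
have d0 : 0 < delta by rewrite hdelta divr_gt0 // mulr_gt0.
have bd : b * delta = 1 / 16 by rewrite hdelta; field; rewrite lt0r_neq0.
have d16 : delta <= 1 / 16.
  by rewrite -bd ler_peMl // ltW.
have Bu : B <= u / 16.
  by rewrite -(ler_pM2l b0); lra.
have su : s * n <= u / 64 + n.
  rewrite -(ler_pM2l b0); have : 64 * b * (s - 1) * n <= n * n by rewrite ler_wpM2r //; lra.
  by rewrite -expr2 uE; lra.
have nu : 3 * (7 + 2 * M) * n <= u.
  rewrite -(ler_pM2l b0) -uE; have : 3 * b * (7 + 2 * M) * n <= n * n by rewrite ler_wpM2r //; lra.
  by rewrite -expr2; lra.
have m0 : 0 <= m by lra.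
have bm : (u - n) / 2 <= beta * m.
  have le1 : 1 / b * m <= beta * m by rewrite ler_wpM2r.
  apply: le_trans le1; rewrite mE.
  have -> : 1 / b * (n * (n - 1) / 2) = (u - n / b) / 2 by rewrite /u; field; rewrite lt0r_neq0.
  have : n / b <= n by rewrite ler_pdivrMr // ler_peMr //; lra.
  lra.
have dex : delta * ex <= u / 32.
  have : delta * ex <= delta * (n ^+ 2 / 2).
    by rewrite ler_wpM2l ?(ltW d0) // (le_trans exm) // mE expr2; nra.
  rewrite uE; have -> : delta * (b * u / 2) = (b * delta) * u / 2 by ring.
  by rewrite bd; lra.
have u0 : 0 <= u by rewrite divr_ge0 ?sqr_ge0 // ltW.
have nM0 : 0 <= n * M by rewrite mulr_ge0 //; lra.
have sn0 : 0 <= s * n by rewrite mulr_ge0 //; lra.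
have bm0 : 0 <= beta * m by rewrite mulr_ge0 // (le_trans _ hbeta) // divr_ge0 // ltW.
suff gap : 2 * ex + n + 2 * (n * M) + u / 4 < Q.
  by have := gap; rewrite -(ltr_pM2l b0) uE; lra.
rewrite ltNge; apply/negP => Qle.
set X := n + 2 * (n * M) + u / 4 + u / 16 + 4 * (u / 64 + n).
have le1 : (1 + delta) * (Q + B + 4 * (s * n)) <= (1 + delta) * (2 * ex + X).
  by rewrite ler_wpM2l; rewrite /X; lra.
have X0 : 0 <= X by rewrite /X; lra.
have dX : delta * X <= 1 / 16 * X by rewrite ler_wpM2r.
have dbm : delta * (beta * m) <= 1 / 16 * (beta * m) by rewrite ler_wpM2r.
have e1 : 2 * (1 - delta) * (ex + beta * m) =
  2 * ex + 2 * (beta * m) - 2 * (delta * ex) - 2 * (delta * (beta * m)) by ring.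
have e2 : (1 + delta) * (2 * ex + X) = 2 * ex + X + 2 * (delta * ex) + delta * X by ring.
have XE : X = n + 2 * (n * M) + u / 4 + u / 16 + 4 * (u / 64 + n) by [].
rewrite {}e1 in lt; rewrite {}e2 in le1.
have {}nu : 21 * n + 6 * (n * M) <= u by move: nu; lra.
clearbody X; move: dX dbm dex bm nu X0 lt le1 XE Bu su u0 n1; clear.
move: (delta * X) (delta * ex) (delta * (beta * m)) (beta * m) (n * M) => *.
lra.
Qed.

Lemma turan_ex_complete_le (S : finType) n (H : sgraph S) :
  (turan_ex (complete 'I_n) H <= 'C(n, 2))%N.
Proof.
apply/bigmax_leqP => F _; apply: leq_trans (subset_leq_card (edges_pairs F)) _.
by rewrite /pairs card_draws card_ord.
Qed.

Section Transference.
Variables (R : realType) (b E M g L : nat).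
Hypotheses (b_ge2 : (2 <= b)%N) (E_large : (2000 * (16 * b) * (16 * b) * (b + 3) < E)%N)
  (ME : M = part_bound (16 * b) E) (gE : g = (64 * b * M)%N)
  (L_large : (g * (E + 4 * (16 * b) * (M + 2 + (2 * M + 2) * (M * M) + 6 * M + 7)) <= L)%N).

Lemma transference (n : nat) (p beta : R) (G F : sgraph 'I_n) t :
  (8 * L ^ 2 <= n)%N -> (3 * b * (7 + 2 * M) <= n)%N -> (2 <= n)%N ->
  0 < p -> 1 / b%:R <= beta ->
  (forall h, (b ^ h.-1 <= n)%N -> (2 * h + 4 * M + 2 < t)%N) ->
  pseudorandom p g (1 / (16 * b%:R)) G -> edges F \subset edges G ->
  ((turan_ex (complete 'I_n) (cycle_graph t))%:R / 'C(n, 2)%:R + beta) * (num_edges G)%:R <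
    (num_edges F)%:R -> has_copy (cycle_graph t) F.
Proof.
move=> n_large1 n_large2 n2 p0 hbeta t_large prG FG many.
have n0 : (0 < n)%N by apply: leq_trans n2.
have b0 : (0 < b)%N by apply: leq_trans b_ge2.
have V0 : (0 < #|'I_n|)%N by rewrite card_ord.
have E6 : (6 <= E)%N.
  apply: leq_trans E_large; rewrite ltnS; apply: leq_trans (_ : 1 * (3 * 1) * (1 * 1) * 3 <= _)%N => //.
  by rewrite !leq_mul // ?leq_addl // leq_mul.
have [K [chi [cK cbad]]] := regular_partition (adjacent F) (16 * b) E V0.
rewrite -ME in cK.
have M0 : (0 < M)%N.
  by apply: leq_trans cK; apply/card_gt0P; exists (chi (Ordinal n0)).
have g0 : (0 < g)%N by rewrite gE muln_gt0 M0 andbT muln_gt0.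
have [h [h1 h2 h3]] := exists_depth b_ge2 E6 n0.
have log_le := depth_small b_ge2 h3 n_large1.
case: t => [|t'] in t_large many *; first by have := t_large h h3.
have b16 : (2 <= 16 * b)%N by apply: leq_trans b_ge2 _; rewrite leq_pmull.
(* Trimming by [1 / (16 * b)] and the passage to the core with [y = 16 * b] each use half of the
   surplus provided by [pairs_gap]. *)
apply: (@has_cycle_of_reduced _ K F chi E g (16 * b) (16 * b) V0 b h t') => //.
- by rewrite muln_gt0 b0.
- rewrite card_ord; apply: leq_trans log_le.
  apply: leq_trans (leq_mul L_large (leqnn _)); rewrite -[leqRHS]mulnA leq_mul2l; apply/orP; right.
  rewrite /overhead /final_slack [leqRHS]mulnDl leq_add ?leq_pmulr // -[leqRHS]mulnA leq_mul2l.
  have kk : (#|K| * #|K| <= M * M)%N by apply: leq_mul.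
  apply/orP; right.
  have -> : ((M + 2 + (2 * M + 2) * (M * M) + 6 * M + 7) * h.+1 =
     (M + 2 + (2 * M + 2) * h.+1 * (M * M) + (6 * M + 7)) + h * (M + 2 + 6 * M + 7))%N.
    by clear; lia.
  have le1 : (h + 2 * #|K| + 1 <= (2 * M + 2) * h.+1)%N by move: cK; clear; nia.
  have := leq_mul le1 kk; have : (3 * h <= h * 7)%N by rewrite mulnC leq_mul2l orbT.
  move: cK; move: (_ * (#|K| * #|K|))%N (_ * (M * M))%N => x y c1 c2 c3.
  have : (h * 7 <= h * (M + 2 + 6 * M + 7))%N by rewrite leq_mul2l leq_addl orbT.
  by clear - c1 c2 c3; lia.
- by rewrite card_ord.
- by rewrite card_ord.
- by apply: leq_ltn_trans (t_large h h3); rewrite /min_gap leq_add2r leq_add2l leq_mul2l cK.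
have bR : 2 <= b%:R :> R by rewrite (ler_nat R 2).
have nR : 2 <= n%:R :> R by rewrite (ler_nat R 2).
set delta := 1 / (16 * b%:R) in prG.
have d0 : 0 < delta by rewrite divr_gt0 // mulr_gt0 //; lra.
pose s := (M * n %/ g).+1.
have sE : (64 * b * (s - 1) <= n)%N.
  rewrite /s subn1 /=; rewrite -(leq_pmul2r M0) mulnAC -gE mulnC [(n * M)%N]mulnC.
  exact: leq_divM.
have sn : (s <= n)%N.
  have le1 : (64 * s.-1 <= n)%N.
    by apply: leq_trans sE; rewrite subn1 leq_mul2r leq_pmulr ?orbT.
  by move: le1 n2; rewrite /s /=; clear; lia.
have := @arcs_count R n p delta g M s G F K chi E FG prG (ltW p0) d0 g0 cK M0 erefl sn.
rewrite card_arcs; set Q := #|rel_pairs _ _|; set B := #|cls_pairs _ _| => count.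
set ex := turan_ex _ _ in many *; set m := 'C(n, 2) in many *.
have mE : m%:R = n%:R * (n%:R - 1) / 2 :> R by apply: bin2R.
have m0 : 0 < m%:R :> R by rewrite mE divr_gt0 // mulr_gt0 //; lra.
have beta0 : 0 <= beta by apply: le_trans hbeta; rewrite divr_ge0 //; lra.
have prE : (1 - delta) * p * m%:R <= (num_edges G)%:R by have /andP[] := prG.
have lower : (1 - delta) * p * (ex%:R + beta * m%:R) < (num_edges F)%:R.
  apply: le_lt_trans many; have -> : (1 - delta) * p * (ex%:R + beta * m%:R) =
    (ex%:R / m%:R + beta) * ((1 - delta) * p * m%:R) by field; rewrite lt0r_neq0.
  by rewrite ler_wpM2l // addr_ge0 // divr_ge0 // ltW.
have key : 2 * (1 - delta) * (ex%:R + beta * m%:R) <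
    (1 + delta) * (Q%:R + B%:R + 4 * (s%:R * n%:R)) :> R.
  rewrite -(ltr_pM2l p0); move: count lower.
  rewrite natrM (natrD _ (Q + B)) (natrD _ Q) (natrM _ 4) (natrM _ s); lra.
have Qgap : 16 * b%:R * (2 * ex%:R + n%:R + 2 * (n%:R * M%:R)) + 4 * n%:R ^+ 2 < 16 * b%:R * Q%:R :> R.
  apply: (@pairs_gap R b%:R n%:R M%:R ex%:R Q%:R B%:R s%:R beta delta m%:R) => //; try lra.
  - by rewrite ler_nat turan_ex_complete_le.
  - by move: cbad; rewrite -/B card_ord -(ler_nat R) !natrM expr2.
  - by move: sE; rewrite -(ler_nat R) !natrM natrB.
  - by move: n_large2; rewrite -(ler_nat R) !natrM natrD natrM.
rewrite card_ord -(ltr_nat R) [ltRHS](natrM _ (16 * b)) (natrM _ 16 b); apply: le_lt_trans Qgap.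
set fl := (n %/ (16 * b))%N.
have flE : 16 * b%:R * fl%:R <= n%:R :> R.
  by rewrite -!natrM ler_nat mulnC leq_divM.
have kM : #|K|%:R <= M%:R :> R by rewrite ler_nat.
rewrite (natrD _ (_ * _)) (natrM _ 2 (n * n)) (natrM _ n n) (natrM _ (16 * b)) (natrM _ 16 b).
rewrite (natrD _ (_ + _)) (natrD _ (_ * _)) (natrM _ 2 ex) (natrM _ 2 (_ * _)) (natrM _ n) natrD.
have le1 := ler_wpM2l (ler0n R n) flE.
have le2 : 16 * b%:R * n%:R * #|K|%:R <= 16 * b%:R * n%:R * M%:R :> R.
  by rewrite ler_wpM2l // !mulr_ge0 //.
by rewrite expr2; lra.
Qed.
End Transference.

Theorem corollary1p10 (R : realType) :
  exists C1 C2 : R, [/\ 0 < C1, 0 < C2 &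
    forall beta : R, 0 < beta -> beta < 1 / 5 ->
      exists2 C : R, 0 < C &
      exists2 c : R, 0 < c &
      exists N : nat, forall n : nat, (N <= n)%N ->
      forall p : R, 0 <= p -> p <= 1 -> C / n%:R <= p ->
      forall t : nat,
        C1 / ln (1 / beta) * ln n%:R <= t%:R ->
        t%:R <= (1 - C2 * beta) * n%:R ->
        1 - expR (- (c * n%:R)) <=
        Gnp_prob p (fun G : sgraph 'I_n =>
          (turan_ex G (cycle_graph t))%:R <=
          ((turan_ex (complete 'I_n) (cycle_graph t))%:R / 'C(n, 2)%:R + beta)
            * (num_edges G)%:R)].
Proof.
exists 4, 1; split=> // beta beta0 beta5.
have inv5 : 5 < 1 / beta by rewrite ltr_pdivlMr //; lra.
(* [b] serves both as the integer form of [1 / beta] in the counting and as the arity of the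
   trees. *)
have [b hb] : exists b : nat, 1 / beta < b%:R.
  by exists (Num.bound (1 / beta)); apply: archi_boundP; lra.
have b_ge2 : (2 <= b)%N by rewrite -(ler_nat R); lra.
have b_beta : 1 / b%:R <= beta.
  have b0 : 0 < b%:R :> R by lra.
  by rewrite ler_pdivrMr //; move: hb; rewrite ltr_pdivrMr //; lra.
have [E E_large] : exists E, (2000 * (16 * b) * (16 * b) * (b + 3) < E)%N.
  by eexists; apply: ltnSn.
have [M ME] : exists M, M = part_bound (16 * b) E by eexists.
have [g gE] : exists g, g = (64 * b * M)%N by eexists.
have [L L_large] : exists L,
    (g * (E + 4 * (16 * b) * (M + 2 + (2 * M + 2) * (M * M) + 6 * M + 7)) <= L)%N.
  by eexists; apply: leqnn.
have bR : 2 <= b%:R :> R by rewrite (ler_nat R 2).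
pose delta : R := 1 / (16 * b%:R).
have d0 : 0 < delta by rewrite divr_gt0 // mulr_gt0 //; lra.
have d1 : delta <= 1 by rewrite ler_pdivrMr ?mulr_gt0 //; lra.
have g0 : (0 < g)%N.
  by rewrite gE ME muln_gt0 part_bound_gt0 andbT muln_gt0 (ltnW b_ge2).
exists (64 * g%:R ^+ 2 / delta ^+ 2).
  by rewrite divr_gt0 ?exprn_gt0 // mulr_gt0 // exprn_gt0 // ltr0n.
(* The first term makes the overheads fit into the smallest class in use, the second lets [ln n]
   absorb the additive constants in the lower bound on [t], and the third dominates the linear terms
   of the count. *)
exists 1 => //; exists (8 * L ^ 2 + b ^ (4 * M + 5) + 3 * b * (7 + 2 * M) + 2)%N.
move=> n n_large p p0 p1 hp t ht _; rewrite mul1r.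
have [n1 n2 n3 n4] : [/\ (8 * L ^ 2 <= n)%N, (b ^ (4 * M + 5) <= n)%N,
    (3 * b * (7 + 2 * M) <= n)%N & (2 <= n)%N].
  move: n_large; move: (8 * _)%N (b ^ _)%N (3 * _ * _)%N => x y z; clear => le_n.
  by split; apply: leq_trans le_n; lia.
have nR : 0 < n%:R :> R by rewrite ltr0n; apply: leq_trans n4.
have p_gt0 : 0 < p.
  apply: lt_le_trans hp; rewrite divr_gt0 // divr_gt0 ?exprn_gt0 //.
  by rewrite mulr_gt0 // exprn_gt0 // ltr0n.
have ln0 : 0 < ln (1 / beta) by apply: ln_gt0; lra.
have lnb : ln (1 / beta) <= ln b%:R by rewrite ler_ln ?posrE; lra.
have pow_le k : (b ^ k <= n)%N -> k%:R * ln (1 / beta) <= ln n%:R.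
  move=> bk; apply: (@le_trans _ _ (k%:R * ln b%:R)); first by rewrite ler_wpM2l.
  rewrite mulr_natl -lnXn; last by lra.
  by rewrite ler_ln ?posrE ?exprn_gt0 //; [rewrite -natrX ler_nat | lra].
(* The origin of the constant 4: two of the four [ln n] pay for the depth [h.-1] of the two trees at
   the closing, and two for [2 * (4 * M + 5)], which covers the walks and the edges. *)
have t_large h : (b ^ h.-1 <= n)%N -> (2 * h + 4 * M + 2 < t)%N.
  move=> /pow_le h1; have h2 := pow_le _ n2.
  have ht' : 4 * ln n%:R <= t%:R * ln (1 / beta).
    by rewrite -ler_pdivrMr // mulrAC.
  have : (2 * h.-1 + 2 * (4 * M + 5))%N%:R * ln (1 / beta) <= t%:R * ln (1 / beta).
    apply: le_trans ht'; rewrite natrD (natrM _ 2 h.-1) (natrM _ 2 (_ + _)).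
    by move: h1 h2; set x := (_ + _)%N%:R; lra.
  by rewrite ler_pM2r // ler_nat; clear; lia.
have hx : 64 * g%:R ^+ 2 <= delta ^+ 2 * (64 * g%:R ^+ 2 / delta ^+ 2).
  by rewrite [leRHS]mulrC divfK // expf_neq0 // lt0r_neq0.
have d01 : 0 < delta <= 1 by rewrite d0.
apply: le_trans (pseudorandom_prob p0 p1 g0 d01 n4 hx hp) _.
apply: Gnp_prob_sub => // G; rewrite !unfold_in => prG.
have rhs0 : 0 <= ((turan_ex (complete 'I_n) (cycle_graph t))%:R / 'C(n, 2)%:R + beta)
    * (num_edges G)%:R :> R.
  by rewrite mulr_ge0 // addr_ge0 ?divr_ge0 // ltW.
rewrite [X in X%:R <= _]/turan_ex.
elim/big_ind: _ => // [x y hx' hy'|F /andP[FG noC]].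
  by rewrite /maxn; case: ifP.
rewrite leNgt; apply/negP => many; case/negP: noC.
exact: (transference b_ge2 E_large ME gE L_large n1 n3 n4 p_gt0 b_beta t_large prG FG many).
Qed.
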